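(* Let $p$ be a prime number or zero, let $(F,K;\chi)$ be a model of $\mathrm{ACFC}_p$, and let $D\subseteq F^m$. If $D$ is definable, then $D$ is definable in the field $F$. If $D$ is $0$-definable, then $D$ is $0$-definable in the field $F$. Suppose $D=\chi^{-1}(V)$ with $V\subseteq K^m$ a $K$-algebraic set. Then $D$ is $F$-algebraic. If moreover $V$ is defined over $\mathbb{Q}$ in the field sense, then $D$ is defined over $\mathbb{F}_p$ in the field sense.
   Context: A character $\chi:F\to K$ between integral domains is a map with $\chi(ab)=\chi(a)\chi(b)$ for all $a,b\in F$, $\chi(0)=0$ and $\chi(1)=1$. A structure $(F,K;\chi)$ of this kind is a structure in the $2$-sorted language $L$, which consists of two disjoint copies of the language of rings (one for each sort) augmented by a unary function symbol $\chi$ from the first sort to the second. For $n\ge 1$, $\alpha\in F^n$ and $k\in\mathbb{N}^n$ put $\alpha^k=\alpha_1^{k_1}\cdots\alpha_n^{k_n}$. The tuple $\alpha$ is multiplicatively dependent if $\alpha^k=\alpha^l$ for some distinct $k,l\in\mathbb{N}^n$, and multiplicatively independent otherwise. A character $\chi:F\to K$ is generic if it is injective and, for every $n\ge1$ and every multiplicatively independent $\alpha\in F^n$, the tuple $\chi(\alpha)=(\chi(\alpha_1),\dots,\chi(\alpha_n))$ is algebraically independent, in the fraction field of $K$, over its prime field. $\mathrm{ACFC}$ is a recursive set of $\forall\exists$-sentences of $L$ whose models are exactly the structures $(F,K;\chi)$ with $F,K$ algebraically closed fields, $\mathrm{char}(K)=0$ and $\chi$ a generic character. For $p$ prime or zero,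 $\mathrm{ACFC}_p$ is $\mathrm{ACFC}$ together with sentences expressing $\mathrm{char}(F)=p$. For $p=0$ we set $\mathbb{F}_p:=\mathbb{Q}$. Definable (resp. $0$-definable) means definable in the $L$-structure $(F,K;\chi)$ with parameters (resp. without parameters); definable (resp. $0$-definable) in the field $F$ means definable with (resp. without) parameters in the structure $F$ in the language of rings. A $K$-algebraic (resp. $F$-algebraic) set is a Zariski closed subset of $K^m$ (resp. $F^m$). A Zariski closed set is defined over a subfield, in the field sense, if it is the zero set of a system of polynomials with coefficients in that subfield. Also $\chi^{-1}(V)=\{\alpha\in F^m:(\chi(\alpha_1),\dots,\chi(\alpha_m))\in V\}$. *)

(* Defs.v *)
From HB Require Import structures.
From mathcomp Require Import all_boot all_order all_algebra.
From mathcomp Require Import mpoly.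

Set Implicit Arguments.
Unset Strict Implicit.
Unset Printing Implicit Defensive.

Import GRing.Theory.
Local Open Scope ring_scope.

(* Points of R^n are n.-tuple R; subsets of R^n are predicates
   n.-tuple R -> Prop. *)

(* The characteristic of R is p, where p is a prime number or 0. *)
Definition has_char (R : nzRingType) (p : nat) : Prop :=
  if p is 0%N then [pchar R] =i pred0 else p \in [pchar R].

Definition prime_field (L : fieldType) (x : L) : Prop :=
  forall S : {pred L}, divring_closed S -> x \in S.

(* The copies in L of the field of rational numbers (for L of characteristic
   0) and of F_p (for L of characteristic p), where F_0 is the field of
   rational numbers. *)
Definition rat_sub (L : fieldType) (x : L) : Prop :=
  exists q : rat, x = ratr q.

Definition Fp_sub (p : nat) (L : fieldType) (x : L) : Prop :=
  if p is 0%N then rat_sub x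
  else exists c : 'F_p, x = (nat_of_ord c)%:R.

Definition is_character (F K : idomainType) (chi : F -> K) : Prop :=
  [/\ {morph chi : a b / a * b}, chi 0 = 0 & chi 1 = 1].

Definition tuple_exp (R : idomainType) n (a : n.-tuple R) (k : n.-tuple nat) :=
  \prod_(i < n) tnth a i ^+ tnth k i.

Definition mult_dependent (R : idomainType) n (a : n.-tuple R) : Prop :=
  exists k l : n.-tuple nat, k <> l /\ tuple_exp a k = tuple_exp a l.

Definition mult_independent (R : idomainType) n (a : n.-tuple R) : Prop :=
  ~ mult_dependent a.

(* Algebraic independence over the prime field of L. *)
Definition alg_independent (L : fieldType) n (a : n.-tuple L) : Prop :=
  forall P : {mpoly L[n]},
    (forall mon, prime_field P@_mon) -> P.@[tnth a] = 0 -> P = 0.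

Definition is_generic (F K : idomainType) (chi : F -> K) : Prop :=
  injective chi /\
  forall n (a : n.-tuple F), (0 < n)%N -> mult_independent a ->
    alg_independent [tuple of [seq tofrac (chi x) | x <- a]].

(* (F, K; chi) is a model of ACFC_p. *)
Definition is_ACFC_model (p : nat) (F K : closedFieldType) (chi : F -> K) :
    Prop :=
  [/\ has_char F p, has_char K 0%N, is_character chi & is_generic chi].

(* The language of rings. Formulas are well scoped: a term or formula of index
   n has its free variables among the n variables with index i : 'I_n. A
   quantifier binds variable 0 and shifts the others. *)
Inductive ring_term (n : nat) : Type :=
| RVar of 'I_n
| RZero
| ROne
| RAdd of ring_term n & ring_term n
| ROpp of ring_term n
| RMul of ring_term n & ring_term n.

Inductive ring_formula (n : nat) : Type :=
| REq of ring_term n & ring_term n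
| RNot of ring_formula n
| RAnd of ring_formula n & ring_formula n
| ROr of ring_formula n & ring_formula n
| RImplies of ring_formula n & ring_formula n
| RExists of ring_formula n.+1
| RForall of ring_formula n.+1.

Fixpoint ring_eval (R : nzRingType) n (e : n.-tuple R) (t : ring_term n) : R :=
  match t with
  | RVar i => tnth e i
  | RZero => 0
  | ROne => 1
  | RAdd t u => ring_eval e t + ring_eval e u
  | ROpp t => - ring_eval e t
  | RMul t u => ring_eval e t * ring_eval e u
  end.

Fixpoint ring_holds (R : nzRingType) n (e : n.-tuple R) (f : ring_formula n) :
    Prop :=
  match f with
  | REq t u => ring_eval e t = ring_eval e u
  | RNot f => ~ ring_holds e f
  | RAnd f g => ring_holds e f /\ ring_holds e g
  | ROr f g => ring_holds e f \/ ring_holds e g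
  | RImplies f g => ring_holds e f -> ring_holds e g
  | RExists f => exists x, ring_holds [tuple of x :: e] f
  | RForall f => forall x, ring_holds [tuple of x :: e] f
  end.

(* The two-sorted language L: index n counts the variables of the first sort,
   index k those of the second. Terms of the first sort are ring terms. *)
Inductive Kterm (n k : nat) : Type :=
| KVar of 'I_k
| KChi of ring_term n
| KZero
| KOne
| KAdd of Kterm n k & Kterm n k
| KOpp of Kterm n k
| KMul of Kterm n k & Kterm n k.

Inductive Lformula (n k : nat) : Type :=
| LEqF of ring_term n & ring_term n
| LEqK of Kterm n k & Kterm n k
| LNot of Lformula n k
| LAnd of Lformula n k & Lformula n k
| LOr of Lformula n k & Lformula n k
| LImplies of Lformula n k & Lformula n k
| LExistsF of Lformula n.+1 k
| LForallF of Lformula n.+1 k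
| LExistsK of Lformula n k.+1
| LForallK of Lformula n k.+1.

Fixpoint Keval (F K : idomainType) (chi : F -> K) n k
    (e : n.-tuple F) (d : k.-tuple K) (t : Kterm n k) : K :=
  match t with
  | KVar i => tnth d i
  | KChi t => chi (ring_eval e t)
  | KZero => 0
  | KOne => 1
  | KAdd t u => Keval chi e d t + Keval chi e d u
  | KOpp t => - Keval chi e d t
  | KMul t u => Keval chi e d t * Keval chi e d u
  end.

Fixpoint Lholds (F K : idomainType) (chi : F -> K) n k
    (e : n.-tuple F) (d : k.-tuple K) (f : Lformula n k) : Prop :=
  match f with
  | LEqF t u => ring_eval e t = ring_eval e u
  | LEqK t u => Keval chi e d t = Keval chi e d u
  | LNot f => ~ Lholds chi e d f
  | LAnd f g => Lholds chi e d f /\ Lholds chi e d g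
  | LOr f g => Lholds chi e d f \/ Lholds chi e d g
  | LImplies f g => Lholds chi e d f -> Lholds chi e d g
  | LExistsF f => exists x, Lholds chi [tuple of x :: e] d f
  | LForallF f => forall x, Lholds chi [tuple of x :: e] d f
  | LExistsK f => exists y, Lholds chi e [tuple of y :: d] f
  | LForallK f => forall y, Lholds chi e [tuple of y :: d] f
  end.

(* Parameters are values b, c of additional free variables; 0-definable sets
   are those defined without them. *)
Definition definable (F K : idomainType) (chi : F -> K) m
    (D : m.-tuple F -> Prop) : Prop :=
  exists (r s : nat) (f : Lformula (m + r)%N s) (b : r.-tuple F) (c : s.-tuple K),
    forall a, D a <-> Lholds chi [tuple of a ++ b] c f.

Definition definable0 (F K : idomainType) (chi : F -> K) m
    (D : m.-tuple F -> Prop) : Prop :=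
  exists f : Lformula m 0%N, forall a, D a <-> Lholds chi a [tuple] f.

Definition field_definable (F : fieldType) m (D : m.-tuple F -> Prop) : Prop :=
  exists (r : nat) (f : ring_formula (m + r)%N) (b : r.-tuple F),
    forall a, D a <-> ring_holds [tuple of a ++ b] f.

Definition field_definable0 (F : fieldType) m (D : m.-tuple F -> Prop) : Prop :=
  exists f : ring_formula m, forall a, D a <-> ring_holds a f.

Definition zero_set (L : fieldType) m (S : {mpoly L[m]} -> Prop)
    (a : m.-tuple L) : Prop :=
  forall P, S P -> P.@[tnth a] = 0.

Definition is_algebraic (L : fieldType) m (V : m.-tuple L -> Prop) : Prop :=
  exists S : {mpoly L[m]} -> Prop, forall a, V a <-> zero_set S a.

Definition defined_over (L : fieldType) (k : L -> Prop) m
    (V : m.-tuple L -> Prop) : Prop :=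
  exists S : {mpoly L[m]} -> Prop,
    (forall P, S P -> forall mon, k P@_mon) /\ forall a, V a <-> zero_set S a.

Definition chi_preimage (F K : idomainType) (chi : F -> K) m
    (V : m.-tuple K -> Prop) (a : m.-tuple F) : Prop :=
  V [tuple of map chi a].

(* Main.v *)
Require Import Defs.
From HB Require Import structures.
From mathcomp Require Import all_boot all_order all_algebra.
From mathcomp Require Import all_fingroup all_solvable all_field.
From mathcomp Require Import mpoly zify.
From Stdlib Require Import Classical FunctionalExtensionality.

(** Everything rests on one fact about sums  c_1 chi(u_1) + ... + c_n chi(u_n)
    with integer coefficients. Call two nonzero elements of F equivalent when
    their quotient is a root of unity of order dividing n!. Such a sum vanishes
    only if its restriction to every equivalence class vanishes
    ([vanishing_sum_classes]). The values of chi on a multiplicatively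
    independent tuple are algebraically independent, also over the roots of
    unity, so the sum splits along the classes modulo all torsion
    ([vanishing_sum_torsion]); inside a class one is left with a vanishing sum
    of roots of unity, and Mann's argument, which averages over Galois
    conjugates, bounds the orders ([vanishing_sum_dvd]). Hence the solution set
    of a relation is a finite union of linear subspaces of a power of F whose
    equations involve a root of unity w, and the union does not depend on the
    choice of w among the primitive roots of its order
    ([vanishing_sum_linear]). So it is 0-definable in F, and closed over the
    prime field ([vanishing_sum_separation]).

    Preimages of algebraic sets. For a polynomial P over K the condition
    P(chi(a)) = 0 says that the vector of the chi(a^k) is orthogonal to the
    vector of the coefficients of P. On vectors with entries in the ring
    generated by the values of chi this is equivalent to finitely many linear
    equations with coefficients in that ring ([chi_ring_equations]), that is, to
    vanishing sums in monomials of a with coefficients from F.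

    Definable sets. Fix finitely many monomials in the variables y of the second
    sort. The tuples z over F for which the combination of these monomials of y
    with coefficients chi(z_t) is zero are those for which the vector chi(z) lies
    in the span of finitely many chi(g_s), where the number of the g_s depends
    only on the number of monomials. So the family g, a code, carries all the
    information on y up to the chosen complexity, and lives in F. The claim,
    proved by induction on formulas, is that the truth of a formula at (x, y) is
    a first-order property in the field F of x and of any code of y for suitable
    monomials ([nf_Lholds]). Quantifiers over F are harmless since codes do not
    involve x. A quantifier over y0 in K amounts to asking which g are codes of
    (y0, y) for some y0. The equations that g imposes on y0 are polynomials in
    y0. If they all vanish identically, a large integer y0 will do whenever any y0
    does, because it satisfies only those equations of the given complexity that
    vanish identically ([vanishing_sum_large_base]). If not, y0 is one of boundedly many roots, and
    there is no suitable root exactly when a product of boundedly many of the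
    forbidden polynomials lies in the ideal of the imposed ones
    ([exists_code_iff]); this is a rank condition, hence again expressible
    through a code of y. For a formula without variables of the second sort,
    being a code is itself 0-definable in F, and for a formula with parameters
    from K a code of the parameters becomes a tuple of parameters from F. *)

Set Implicit Arguments.
Unset Strict Implicit.
Unset Printing Implicit Defensive.

Import GRing.Theory.
Local Open Scope ring_scope.

(** * Vanishing sums of roots of unity in characteristic zero *)

Lemma intr_eq0_char0 (K : fieldType) (charK : [pchar K] =i pred0) (c : int) :
  (c%:~R == 0 :> K) = (c == 0).
Proof.
have nat0 n : (n%:R == 0 :> K) = (n == 0)%N by move/pcharf0P: charK.
case: c => n; first exact: nat0.
by rewrite NegzE rmorphN oppr_eq0 [_%:~R == _]nat0.
Qed.

(** X^n - 1 is the product of the integral cyclotomic polynomials in every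
    ring, and a root of the d-th one is a d-th root of unity. *)
Lemma Cyclotomic_root (K : fieldType) n (w : K) :
  n.-primitive_root w -> root (map_poly intr 'Phi_n) w.
Proof.
move=> prim_w; have n_gt0 := prim_order_gt0 prim_w.
have map_Xn1 d : map_poly intr ('X^d - 1) = 'X^d - 1 :> {poly K}.
  by rewrite rmorphB /= map_polyXn rmorph1.
have : root (map_poly intr ('X^n - 1)) w.
  by rewrite map_Xn1 rootE !hornerE prim_expr_order // subrr.
rewrite -prod_Cyclotomic // rmorph_prod rootE horner_prod prodf_seq_eq0 /= => /hasP[d d_n w0].
suffices: d == n by move/eqP=> <-.
rewrite -dvdn_divisors // in d_n; rewrite eqn_dvd d_n /=.
rewrite (prim_order_dvd prim_w) -subr_eq0.
have d_gt0 : (0 < d)%N by apply: dvdn_gt0 d_n.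
have : root (map_poly intr ('X^d - 1)) w.
  rewrite -prod_Cyclotomic // (big_rem d) -?dvdn_divisors //=.
  by rewrite rmorphM rootM rootE w0.
by rewrite map_Xn1 rootE !hornerE.
Qed.

(** Cyclotomic polynomials are minimal polynomials over the rationals; being
    monic they divide over the integers. *)
Lemma Cyclotomic_min n (z : algC) (f : {poly int}) :
  n.-primitive_root z -> root (map_poly intr f) z ->
  exists g, f = 'Phi_n * g.
Proof.
move=> prim_z fz0; have [pf [Dpf mon_pf] dv_pf] := minCpolyP z.
have QZ (h : {poly int}) :
    map_poly ratr (map_poly intr h : {poly rat}) = map_poly intr h :> {poly algC}.
  by rewrite -map_poly_comp; apply: eq_map_poly => b; rewrite /= rmorph_int.
have pfE : pf = map_poly intr 'Phi_n.
  apply: (map_inj_poly (fmorph_inj (@ratr algC))) => //; first exact: rmorph0.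
  by rewrite -Dpf QZ (minCpoly_cyclotomic prim_z) (Cintr_Cyclotomic prim_z).
have : pf %| map_poly intr f by rewrite -dv_pf QZ.
rewrite pfE dvdp_rat_int => /dvdpP_int[g ->]; exists g.
by rewrite zprimitive_monic ?Cyclotomic_monic.
Qed.

(** Galois conjugation without automorphisms of K. As w is a common root, the
    resultant of f and the cyclotomic polynomial vanishes. It is an integer, so
    the two polynomials also have a common root among the algebraic numbers,
    where the irreducibility of the cyclotomic polynomial is known. *)
Lemma primitive_root_conj (K : fieldType) (charK : [pchar K] =i pred0)
    n (w w' : K) (f : {poly int}) :
  n.-primitive_root w -> n.-primitive_root w' ->
  root (map_poly intr f) w -> root (map_poly intr f) w'.
Proof.
move=> prim_w prim_w' fw0.
have n_gt0 := prim_order_gt0 prim_w.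
have Phi_gt1 : (1 < size 'Phi_n)%N by rewrite size_Cyclotomic ltnS totient_gt0.
have [f_le1 | f_gt1] := leqP (size f) 1.
  move: fw0; rewrite (size1_polyC f_le1) map_polyC /= rootC.
  by rewrite intr_eq0_char0 // => /eqP->; rewrite rmorph0 root0.
have [[u v] _ /= res_uv] := resultant_in_ideal f_gt1 Phi_gt1.
have res0 : resultant f 'Phi_n = 0.
  apply/eqP; rewrite -(intr_eq0_char0 charK) -[_%:~R](hornerC _ w).
  rewrite -[_%:P](map_polyC intr) res_uv rmorphD !rmorphM /= !hornerE.
  by rewrite (eqP fw0) (eqP (Cyclotomic_root prim_w)) !mulr0 addr0.
have := resultant_eq0 f 'Phi_n; rewrite res0 eqxx => /esym.
set d := gcdp _ _ => d_gt1.
have [z dz0] : exists z : algC, root (map_poly intr d) z.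
  apply/closed_rootP; rewrite size_map_inj_poly ?rmorph0 //; last exact: intr_inj.
  by rewrite neq_ltn d_gt1 orbT.
have root_z (p : {poly int}) : d %| p -> root (map_poly intr p : {poly algC}) z.
  case/Pdiv.Idomain.dvdpP => [[c h] /= c0 Dh].
  have := congr1 (fun q => (map_poly intr q : {poly algC}).[z]) Dh.
  rewrite /= map_polyZ rmorphM /= hornerZ hornerM (eqP dz0) mulr0 => /eqP.
  by rewrite mulf_eq0 intr_eq0 (negPf c0).
have fz0 := root_z _ (dvdp_gcdl _ _); have Pz0 := root_z _ (dvdp_gcdr f 'Phi_n).
have [z1 prim_z1] := C_prim_root_exists n_gt0.
rewrite (Cintr_Cyclotomic prim_z1) root_cyclotomic // in Pz0.
have [g ->] := Cyclotomic_min Pz0 fz0.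
by rewrite rmorphM rootM Cyclotomic_root.
Qed.

Lemma sum_prim_root_exp (K : fieldType) q (z : K) (k : nat) :
  q.-primitive_root z ->
  \sum_(j < q) z ^+ (j * k) = if (q %| k)%N then q%:R else 0.
Proof.
move=> prim_z; under eq_bigr do rewrite mulnC exprM.
rewrite (prim_order_dvd prim_z); have [-> | zk1] := eqVneq (z ^+ k) 1.
  under eq_bigr do rewrite expr1n.
  by rewrite sumr_const card_ord.
have := subrX1 (z ^+ k) q.
rewrite -exprM mulnC exprM (prim_expr_order prim_z) expr1n subrr => /esym/eqP.
by rewrite mulf_eq0 subr_eq0 (negPf zk1) => /eqP.
Qed.

Lemma coprime_residue_unique N q j j' : prime q -> (j < q)%N -> (j' < q)%N ->
  (q %| 1 + j * N)%N -> (q %| 1 + j' * N)%N -> j = j'.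
Proof.
move=> q_pr; wlog le_jj' : j j' / (j <= j')%N => [IH jq j'q qj qj' | jq j'q qj qj'].
  by case/orP: (leq_total j j') => le; [apply: IH | apply/esym; apply: IH].
have : (q %| (j' - j) * N)%N.
  by rewrite mulnBl -(subnDl 1%N) dvdn_sub.
rewrite Euclid_dvdM // => /orP[q_jj' | q_N]; last first.
  by move: qj; rewrite dvdn_addl ?dvdn_mull // dvdn1 => /eqP q1; rewrite q1 in q_pr.
have : (j' - j < q)%N by apply: leq_ltn_trans (leq_subr _ _) j'q.
rewrite -subn_eq0 in le_jj'.
case: (posnP (j' - j)) => [jj'0 _ | jj'_gt0 lt]; last first.
  by move/dvdn_leq: q_jj' => /(_ jj'_gt0); rewrite leqNgt lt.
by apply/eqP; rewrite eqn_leq -!subn_eq0 (eqP le_jj') jj'0.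
Qed.

(** Multiplying w by a power of the primitive q-th root of unity
    w ^+ (L %/ q) gives a conjugate of w, except possibly for one residue of
    the exponent j modulo q. *)
Lemma dilated_root_primitive (K : fieldType) L q j (w : K) :
  L.-primitive_root w -> prime q -> (q %| L)%N -> ~~ (q %| 1 + j * (L %/ q))%N ->
  L.-primitive_root (w ^+ (1 + j * (L %/ q))).
Proof.
move=> prim_w q_pr q_L.
set N := (L %/ q)%N => q_j; have LE : L = (N * q)%N by rewrite divnK.
rewrite prim_root_exp_coprime // LE coprimeMr [coprime _ q]coprime_sym.
rewrite (prime_coprime _ q_pr) q_j andbT -coprime_modl addnC modnMDl.
by rewrite coprime_modl coprime1n.
Qed.

(** Mann's descent. Let S j be the sum with w replaced by w * z^j, where
    z = w^(L/q). The part B s of the given sum with exponents congruent to -s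
    modulo q is a discrete Fourier transform of the S j, and S j is zero whenever
    w * z^j is conjugate to w. If q * q divides L then every S j vanishes.
    Otherwise one of them, S j0, may survive, so that q * B s = z^(j0 s) * S j0 for all s; a sum
    with fewer than q terms misses some residue class, which forces S j0 = 0. *)
Lemma vanishing_sum_dvd (K : fieldType) (charK : [pchar K] =i pred0)
    (T : finType) (A : pred T) (c : T -> int) (k : T -> nat) L q (w : K) :
  L.-primitive_root w -> prime q -> (q %| L)%N ->
  (q * q %| L)%N || (#|T| < q)%N ->
  \sum_(i | A i) (c i)%:~R * w ^+ k i = 0 ->
  \sum_(i | A i && (q %| k i)%N) (c i)%:~R * w ^+ k i = 0.
Proof.
move=> prim_w q_pr q_L small_q sum0.
set N := (L %/ q)%N; set z := w ^+ N.
have prim_z : q.-primitive_root z by apply: dvdn_prim_root.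
have q_neq0 : q%:R != 0 :> K.
  by move/pcharf0P: charK => ->; rewrite -lt0n prime_gt0.
pose S j := \sum_(i | A i) (c i)%:~R * w ^+ k i * z ^+ (j * k i).
pose B s := \sum_(i | A i && (q %| k i + s)%N) (c i)%:~R * w ^+ k i.
have S0 j : ~~ (q %| 1 + j * N)%N -> S j = 0.
  move=> q_j; have prim_w' := dilated_root_primitive prim_w q_pr q_L q_j.
  pose f : {poly int} := \sum_(i | A i) c i *: 'X^(k i).
  have f_val (x : K) :
      (map_poly intr f).[x] = \sum_(i | A i) (c i)%:~R * x ^+ k i.
    rewrite rmorph_sum horner_sum; apply: eq_bigr => i _ /=.
    by rewrite map_polyZ /= map_polyXn hornerZ hornerXn.
  have := primitive_root_conj charK (f := f) prim_w prim_w'.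
  rewrite !rootE !f_val sum0 eqxx => /(_ isT)/eqP sum'0.
  rewrite -[RHS]sum'0; apply: eq_bigr => i _.
  by rewrite -mulrA /z -!exprM -exprD mulnDl mul1n mulnCA -mulnA.
have BE s : q%:R * B s = \sum_(j < q) z ^+ (j * s) * S j.
  under [RHS]eq_bigr do rewrite mulr_sumr.
  rewrite exchange_big /= /B mulr_sumr big_mkcondr /=; apply: eq_bigr => i _.
  transitivity ((c i)%:~R * w ^+ k i * \sum_(j < q) z ^+ (j * (k i + s))).
    rewrite sum_prim_root_exp //; case: ifP => _; last by rewrite mulr0.
    by rewrite mulrC.
  rewrite mulr_sumr; apply: eq_bigr => j _.
  by rewrite mulnDr exprD mulrA [RHS]mulrC.
have -> : \sum_(i | A i && (q %| k i)%N) (c i)%:~R * w ^+ k i = B 0%N.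
  by apply: eq_bigl => i; rewrite addn0.
apply: (mulfI q_neq0); rewrite mulr0.
have [/existsP[j0 qj0] | no_j] := boolP [exists j : 'I_q, q %| 1 + j * N]%N; last first.
  rewrite BE big1 // => j _; rewrite S0 ?mulr0 //.
  by move/existsPn: no_j => /(_ j).
have BE0 s : q%:R * B s = z ^+ (j0 * s) * S j0.
  rewrite BE (bigD1 j0) //= big1 ?addr0 // => j j_neq; rewrite S0 ?mulr0 //.
  by apply: contraNN j_neq => qj; apply/eqP/val_inj/(coprime_residue_unique q_pr _ _ qj qj0).
have lt_Tq : (#|T| < q)%N.
  case/orP: small_q => // qq_L; move: qj0; rewrite dvdn_addl; last first.
    by rewrite dvdn_mull // -(dvdn_pmul2r (prime_gt0 q_pr)) divnK.
  by rewrite dvdn1 => /eqP q1; rewrite q1 in q_pr.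
have q_gt0 := prime_gt0 q_pr.
have [s s_free] : exists s, forall i, ~~ (q %| k i + s)%N.
  pose h (i : T) : 'I_q := Ordinal (ltn_pmod (q - k i %% q) q_gt0).
  have : ~~ [forall s, s \in codom h].
    apply/negP => /forallP h_surj; have := leq_trans lt_Tq (leqnn q).
    rewrite ltnNge -{1}(card_ord q) -(size_codom h) => /negP; apply.
    apply: leq_trans (card_size (codom h)).
    by apply/subset_leq_card/subsetP => s _; apply: h_surj.
  case/forallPn => s s_h; exists s => i; apply: contra s_h => q_ks.
  apply/codomP; exists i; apply/val_inj => /=.
  have lt_r := ltn_pmod (k i) q_gt0.
  rewrite /dvdn -modnDml in q_ks.
  move: (k i %% q)%N lt_r q_ks => r lt_r /dvdnP[[|[|t]] rs].
  - have [-> ->] : r = 0%N /\ s = 0%N :> nat by move: rs; rewrite mul0n; lia.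
    by rewrite subn0 modnn.
  - have -> : (q - r = s)%N by lia.
    by rewrite modn_small.
  - by have := ltn_ord s; lia.
have : q%:R * B s = 0.
  by rewrite /B big1 ?mulr0 // => i; rewrite (negPf (s_free i)) andbF.
rewrite BE0 => /eqP; rewrite mulf_eq0 expf_eq0 (prim_root_eq0 prim_z).
rewrite (gtn_eqF q_gt0) andbF /= => /eqP Sj0.
by rewrite BE0 Sj0 mulr0.
Qed.

Lemma sum_by_classes (R : zmodType) (T : finType) (V : eqType) (P : pred T)
    (v : T -> V) (f : T -> R) :
  (forall j, P j -> \sum_(i | P i && (v i == v j)) f i = 0) ->
  \sum_(i | P i) f i = 0.
Proof.
move=> class0; pose h i := odflt i [pick j | P j && (v j == v i)].
have hP i j : P i -> P j -> (h i == h j) = (v i == v j).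
  rewrite /h => Pi Pj; apply/eqP/eqP => [|->]; last first.
    by case: pickP => //= /(_ j); rewrite Pj eqxx.
  case: pickP => [i' /andP[_ /eqP <-]|/(_ i)]; last by rewrite Pi eqxx.
  case: pickP => [j' /andP[_ /eqP <-]|/(_ j)]; last by rewrite Pj eqxx.
  by move=> /= ->.
rewrite (partition_big h predT) //=; apply: big1 => j _.
have [i0 /andP[Pi0 /eqP<-]|no_i] := pickP (fun i => P i && (h i == j)).
  rewrite -[RHS](class0 _ Pi0); apply: eq_bigl => i.
  by case Pi: (P i) => //=; rewrite hP.
by rewrite big_pred0.
Qed.

(** * Algebraic independence over cyclotomic fields *)

Lemma primitive_roots_seq (K : fieldType) L (w : K) : L.-primitive_root w ->
  exists rs : seq K, [/\ uniq rs, size rs = totient L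
                       & forall z, z \in rs -> L.-primitive_root z].
Proof.
move=> prim_w; pose s := [seq k : 'I_L <- enum 'I_L | coprime k L].
exists [seq w ^+ (k : 'I_L) | k <- s]; split.
- rewrite map_inj_in_uniq; first exact/filter_uniq/enum_uniq.
  move=> k k' _ _ /eqP; by rewrite (eq_prim_root_expr prim_w) !modn_small // => /eqP/val_inj.
- rewrite size_map size_filter totient_count_coprime big_mkord -sum1_count.
  rewrite big_enum_cond big_mkcond /=; apply: eq_bigr => k _.
  by rewrite coprime_sym; case: (coprime L k).
- move=> z /mapP[k]; rewrite mem_filter => /andP[co_k _] ->.
  by rewrite prim_root_exp_coprime.
Qed.

(** An integral polynomial relation between the b_i and w is a polynomial q in
    one variable, over the domain A of integral polynomials in the b_i, that has
    the root w in common with the cyclotomic polynomial p. The resultant of p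
    and q is an integral polynomial vanishing at b, hence zero. So p and q have
    a common factor d over A. Since p splits into distinct linear factors over
    the polynomials with coefficients in K, some conjugate w' of w is a root of
    d, hence of q identically in the b_i. Each coefficient of q at w' is
    therefore zero, and conjugation brings this back to w. *)
Lemma monomial_relation_split (K : fieldType) (charK : [pchar K] =i pred0)
    r (b : 'I_r -> K) (T : finType) (P : pred T) (c : T -> int) (h : T -> nat)
    (k : T -> 'X_{1..r}) L (w : K) :
  (forall G : {mpoly int[r]}, mmap intr b G = 0 -> G = 0) ->
  L.-primitive_root w ->
  \sum_(i | P i) (c i)%:~R * w ^+ h i * mmap1 b (k i) = 0 ->
  forall m, \sum_(i | P i && (k i == m)) (c i)%:~R * w ^+ h i = 0.
Proof.
move=> b_ind prim_w sum0 m.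
pose A := {mpoly int[r]}; pose AK := {mpoly K[r]}.
pose q : {poly A} := \sum_(i | P i) (c i *: 'X_[k i]) *: 'X^(h i).
pose p : {poly A} := map_poly intr 'Phi_L.
have L_gt0 := prim_order_gt0 prim_w.
(* A conjugate w' of w at which the relation holds identically in b. *)
have [w' prim_w' qw'] : exists2 w' : K, L.-primitive_root w' &
    (map_poly (map_mpoly intr) q : {poly AK}).[w'%:MP] = 0.
  have qw0 : (map_poly (mmap intr b) q).[w] = 0.
    rewrite -[RHS]sum0 rmorph_sum horner_sum; apply: eq_bigr => i _ /=.
    rewrite map_polyZ /= map_polyXn hornerZ hornerXn mmapZ mmapX -mulrA.
    by rewrite [w ^+ _ * _]mulrC mulrA.
  have map_p (S : nzRingType) (f : {rmorphism A -> S}) :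
      map_poly f p = map_poly intr 'Phi_L.
    rewrite /p -map_poly_comp; apply: eq_map_poly => z /=.
    exact: rmorph_int.
  have pw0 : (map_poly (mmap intr b) p).[w] = 0.
    by rewrite map_p; apply/eqP/Cyclotomic_root.
  have size_p : size p = (totient L).+1.
    rewrite -size_Cyclotomic; apply: size_map_poly_id0.
    by rewrite (monicP (Cyclotomic_monic L)) rmorph1 oner_eq0.
  have p_gt1 : (1 < size p)%N by rewrite size_p ltnS totient_gt0.
  have [q_le1 | q_gt1] := leqP (size q) 1.
    exists w => //; move: qw0; rewrite (size1_polyC q_le1) map_polyC hornerC /=.
    by move/b_ind => ->; rewrite !rmorph0 horner0.
  have [[u v] _ /= res_uv] := resultant_in_ideal p_gt1 q_gt1.
  have res0 : resultant p q = 0.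
    apply: b_ind; rewrite -[LHS](hornerC _ w) -(map_polyC (mmap intr b)) res_uv.
    by rewrite rmorphD !rmorphM /= !hornerE qw0 pw0 !mulr0 addr0.
  have := resultant_eq0 p q; rewrite res0 eqxx => /esym.
  set d := gcdp _ _ => d_gt1.
  have /Pdiv.Idomain.dvdpP[[a s] /= a0 Ds] : d %| p by apply: dvdp_gcdl.
  have /Pdiv.Idomain.dvdpP[[a' t] /= a'0 Dt] : d %| q by apply: dvdp_gcdr.
  pose io := @map_mpoly r int K intr; pose pio := map_poly io.
  have io_inj : injective io.
    move=> f g eq_fg; apply/mpolyP => n; apply/eqP; rewrite -subr_eq0.
    rewrite -(intr_eq0_char0 charK) rmorphB subr_eq0 /=.
    by rewrite -!(mcoeff_map_mpoly (R := int) (S := K)) -/io eq_fg.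
  have size_io f : size (pio f) = size f.
    by apply: size_map_inj_poly => //; apply: rmorph0.
  have io_neq0 f : f != 0 -> io f != 0.
    by apply: contraNN => /eqP io0; apply/eqP/io_inj; rewrite io0 /io rmorph0.
  have s_neq0 : s != 0.
    apply/eqP => s0; have := congr1 (fun f : {poly A} => size f) Ds.
    by rewrite s0 mul0r size_scale // size_p size_poly0.
  have size_s : (size s <= totient L)%N.
    have d_neq0 : d != 0 by apply: contraTneq d_gt1 => ->; rewrite size_poly0.
    have size_sd : (totient L).+1 = (size s + size d).-1.
      by rewrite -(size_mul s_neq0 d_neq0) -Ds size_scale.
    move: d_gt1 size_sd; case: (size d) => [|[|n]]; rewrite // !addnS /= => _ [->].
    exact: leq_addr.
  have [rs [uniq_rs size_rs rs_prim]] := primitive_roots_seq prim_w.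
  have [w' w'_rs dw'] : exists2 w', w' \in rs & (pio d).[w'%:MP] = 0.
    have [/hasP[z z_rs /eqP dz0]|] := boolP (has (fun z => (pio d).[z%:MP] == 0) rs).
      by exists z.
    move=> /hasPn rs_d; exfalso.
    have all_s : all (root (pio s)) (map (@mpolyC r K) rs).
      apply/allP => _ /mapP[z z_rs ->].
      have := congr1 (fun f => (pio f).[z%:MP]) Ds.
      rewrite /= /pio map_polyZ map_p rmorphM /= hornerZ hornerM -/pio.
      have -> : (map_poly intr 'Phi_L : {poly AK}).[z%:MP] = 0.
        have -> : map_poly intr 'Phi_L = map_poly (@mpolyC r K) (map_poly intr 'Phi_L).
          by rewrite -map_poly_comp; apply: eq_map_poly => x /=; rewrite rmorph_int.
        by rewrite horner_map /= (eqP (Cyclotomic_root (rs_prim z z_rs))) rmorph0.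
      rewrite mulr0 => /esym/eqP; rewrite mulf_eq0 => /orP[sz0|dz0].
        by rewrite rootE sz0.
      by case/negP: (rs_d z z_rs).
    have pio_s_neq0 : pio s != 0 by rewrite -size_poly_eq0 size_io size_poly_eq0.
    have uniq_s : uniq (map (@mpolyC r K) rs).
      by rewrite map_inj_uniq //; apply: can_inj (@mpolyCK r K).
    have := max_poly_roots pio_s_neq0 all_s uniq_s.
    by rewrite size_map size_rs size_io ltnNge size_s.
  exists w'; first exact: rs_prim.
  have := congr1 (fun f => (pio f).[w'%:MP]) Dt.
  rewrite /= /pio map_polyZ rmorphM /= hornerZ hornerM -/pio dw' mulr0 => /eqP.
  by rewrite mulf_eq0 (negPf (io_neq0 _ a'0)) => /eqP.
have sumw'0 : \sum_(i | P i && (k i == m)) (c i)%:~R * w' ^+ h i = 0.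
  rewrite -[RHS](mcoeff0 _ m) -qw'.
  rewrite rmorph_sum horner_sum raddf_sum big_mkcondr /=; apply: eq_bigr => i _.
  rewrite map_polyZ map_polyXn hornerZ hornerXn /= map_mpolyZ map_mpolyX /=.
  rewrite -rmorphXn /= [X in mcoeff _ X]mulrC mcoeffCM mcoeffZ mcoeffX mulr_natr mulrC.
  by case: eqP => _; rewrite ?mulr1 ?mulr0.
pose f : {poly int} := \sum_(i | P i && (k i == m)) c i *: 'X^(h i).
have f_val (x : K) : (map_poly intr f).[x] =
    \sum_(i | P i && (k i == m)) (c i)%:~R * x ^+ h i.
  rewrite rmorph_sum horner_sum; apply: eq_bigr => i _ /=.
  by rewrite map_polyZ /= map_polyXn hornerZ hornerXn.
have := primitive_root_conj charK (f := f) prim_w' prim_w.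
by rewrite !rootE !f_val sumw'0 eqxx => /(_ isT)/eqP.
Qed.

(** * Multiplicative bases *)

Lemma closed_prim_root_exists (F : closedFieldType) n :
  n%:R != 0 :> F -> exists z : F, n.-primitive_root z.
Proof.
case: n => [/eqP//|n n_neq0]; pose p : {poly F} := 'X^(n.+1) - 1.
have [r Dp] := closed_field_poly_normal p.
rewrite (monicP _) ?monicXnsubC // scale1r in Dp.
have rn1 : all n.+1.-unity_root r by apply/allP=> z; rewrite -root_prod_XsubC -Dp.
have sz_r : (n.+1 < (size r).+1)%N.
  by rewrite -(size_prod_XsubC r id) -Dp size_XnsubC.
have [|z _] := hasP (has_prim_root (ltn0Sn n) rn1 _ sz_r); last by exists z.
by rewrite -separable_prod_XsubC -Dp separable_Xn_sub_1.
Qed.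

Lemma closed_nth_root_exists (F : closedFieldType) n (a : F) :
  (0 < n)%N -> exists x, x ^+ n = a.
Proof.
move=> n_gt0; have [x] : exists x, root ('X^n - a%:P) x.
  by apply/closed_rootP; rewrite size_XnsubC // eqSS -lt0n.
by rewrite rootE !hornerE subr_eq0 => /eqP; exists x.
Qed.

Definition monomial_at (R : comNzRingType) (I : finType) (a : I -> R)
  (k : I -> nat) : R := \prod_i a i ^+ k i.

Section MonomialAt.

Variables (R : comNzRingType) (I : finType).
Implicit Types (a : I -> R) (k l : I -> nat).

Lemma monomial_at0 a : monomial_at a (fun=> 0%N) = 1.
Proof. by rewrite /monomial_at big1. Qed.

Lemma monomial_atD a k l :
  monomial_at a (fun i => k i + l i)%N = monomial_at a k * monomial_at a l.
Proof. by rewrite -big_split; apply: eq_bigr => i _; rewrite exprD. Qed.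

Lemma monomial_at_mulX a k n :
  monomial_at a (fun i => n * k i)%N = monomial_at a k ^+ n.
Proof. by rewrite -prodrXl; apply: eq_bigr => i _; rewrite mulnC exprM. Qed.

Lemma monomial_at_expX a k n :
  monomial_at (fun i => a i ^+ n) k = monomial_at a k ^+ n.
Proof. by rewrite -prodrXl; apply: eq_bigr => i _; rewrite -!exprM mulnC. Qed.

Lemma monomial_at_sum a (J : finType) (P : pred J) (k : J -> I -> nat) :
  monomial_at a (fun i => \sum_(j | P j) k j i)%N =
  \prod_(j | P j) monomial_at a (k j).
Proof.
by rewrite exchange_big; apply: eq_bigr => i _ /=; rewrite expr_sum.
Qed.

End MonomialAt.

(** Multiplicative independence with exponents as functions, which is more
    convenient than tuples when a family is extended by one element. *)
Definition mult_free (R : comNzRingType) r (a : 'I_r -> R) : Prop :=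
  forall k l, monomial_at a k = monomial_at a l -> k =1 l.

Lemma mult_free_independent (R : idomainType) r (a : 'I_r -> R) :
  mult_free a -> mult_independent [tuple a i | i < r].
Proof.
move=> free_a [k [l [neq_kl]]]; rewrite /tuple_exp.
under eq_bigr do rewrite tnth_mktuple.
under [RHS]eq_bigr do rewrite tnth_mktuple.
by move/free_a => eq_kl; case: neq_kl; apply: eq_from_tnth.
Qed.

Definition cons_fun (A : Type) r (x : A) (a : 'I_r -> A) (i : 'I_r.+1) : A :=
  oapp a x (unlift ord0 i).

Lemma monomial_at_cons (R : comNzRingType) r (x : R) (a : 'I_r -> R) k :
  monomial_at (cons_fun x a) k =
  x ^+ k ord0 * monomial_at a (fun i => k (lift ord0 i)).
Proof.
rewrite /monomial_at big_ord_recl /cons_fun unlift_none /=; congr (_ * _).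
by apply: eq_bigr => i _; rewrite liftK.
Qed.

(** Take a maximal multiplicatively free family b in the set: for any other
    element x there is a relation between x and b in which x occurs with a
    nonzero exponent. *)
Lemma mult_basis (F : fieldType) (s : seq F) : 0 \notin s ->
  exists r (b : 'I_r -> F) L, [/\ mult_free b, (0 < L)%N &
    forall x, x \in s -> exists k l,
      x ^+ L * monomial_at b l = monomial_at b k].
Proof.
elim: s => [_|x s IHs]; first by exists 0%N, (fun=> 0), 1%N; split=> // ? ? _ [].
rewrite inE negb_or eq_sym => /andP[x_neq0 /IHs[r [b [L [free_b L_gt0 b_s]]]]].
have [dep|indep] := classic (exists k l a n, [/\ (a < n)%N
    & x ^+ a * monomial_at b k = x ^+ n * monomial_at b l]).
  have [k [l [a [n [lt_an eq_kl]]]]] := dep.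
  have {eq_kl} eq_kl : x ^+ (n - a) * monomial_at b l = monomial_at b k.
    apply: (mulfI (expf_neq0 a x_neq0)).
    by rewrite mulrA -exprD subnKC // ltnW.
  exists r, b, (L * (n - a))%N; split=> //; first by rewrite muln_gt0 L_gt0 subn_gt0.
  move=> y; rewrite inE => /predU1P[->|/b_s[k' [l' eq_kl']]].
    exists (fun i => L * k i)%N, (fun i => L * l i)%N.
    by rewrite !monomial_at_mulX mulnC exprM -exprMn eq_kl.
  exists (fun i => (n - a) * k' i)%N, (fun i => (n - a) * l' i)%N.
  by rewrite !monomial_at_mulX exprM -exprMn eq_kl'.
exists r.+1, (cons_fun x b), L; split=> // [k l|y].
  rewrite !monomial_at_cons => eq_kl; have eq0 : k ord0 = l ord0.
    have [lt|lt|//] := ltngtP (k ord0) (l ord0); case: indep.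
      by do 4!eexists; split; [exact: lt | exact: eq_kl].
    by do 4!eexists; split; [exact: lt | exact: esym eq_kl].
  have eqS : (fun i => k (lift ord0 i)) =1 (fun i => l (lift ord0 i)).
    by apply: free_b; apply: (mulfI (expf_neq0 (k ord0) x_neq0)); rewrite {2}eq0.
  by move=> i; case: (unliftP ord0 i) => [j|] ->.
rewrite inE => /predU1P[->|/b_s[k' [l' eq_kl']]].
  exists (cons_fun L (fun=> 0%N)), (fun=> 0%N).
  rewrite monomial_at0 mulr1 monomial_at_cons /cons_fun unlift_none /=.
  rewrite [monomial_at _ _]big1 ?mulr1 // => i _.
  by rewrite liftK.
exists (cons_fun 0%N k'), (cons_fun 0%N l'); rewrite !monomial_at_cons.
rewrite /cons_fun unlift_none /= !expr0 !mul1r.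
have E (m : 'I_r -> nat) :
    monomial_at b (fun i => oapp m 0%N (unlift ord0 (lift ord0 i))) = monomial_at b m.
  by apply: eq_bigr => i _; rewrite liftK.
by rewrite !E.
Qed.

(** * Ranks, ideals and integral polynomials *)

Section LinearAlgebra.

Variable K : fieldType.

(** The set S need not be a subspace: the point is that the spanning vectors
    are themselves taken from S. *)
Lemma basis_in_set m (S : 'rV[K]_m -> Prop) :
  exists s (B : 'M[K]_(s, m)), [/\ row_free B, forall i, S (row i B)
    & forall r, S r -> (r <= B)%MS].
Proof.
apply: NNPP => no_basis.
have free_in_S s : exists2 B : 'M[K]_(s, m), row_free B & forall i, S (row i B).
  elim: s => [|s [B free_B B_S]].
    by exists 0; [rewrite /row_free mxrank0 | case].
  have [r S_r r_B] : exists2 r, S r & ~~ (r <= B)%MS.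
    apply: NNPP => B_spans; apply: no_basis; exists s, B; split=> // r S_r.
    by apply: contra_notT B_spans => r_B; exists r.
  rewrite -addn1; exists (col_mx B r) => [|i]; last first.
    have [j ->|j ->] := split_ordP i; first by rewrite rowKu.
    by rewrite rowKd row_id.
  rewrite -row_leq_rank -addsmxE addn1 -{1}(eqP free_B).
  have : (B < B + r)%MS by rewrite ltmxE addsmxSl addsmx_sub submx_refl.
  by rewrite ltmxErank => /andP[].
have [B free_B _] := free_in_S m.+1; have := rank_leq_col B.
by rewrite (eqP free_B) ltnn.
Qed.

Definition nz_minor m n (M : 'M[K]_(m, n)) r : Prop :=
  exists f : {ffun 'I_r -> 'I_m}, exists g : {ffun 'I_r -> 'I_n},
    \det (mxsub f g M) <> 0.

(** Nonvanishing minors express ranks, and thus membership in a span, through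
    polynomial conditions on the entries. *)
Lemma nz_minor_rank m n (M : 'M[K]_(m, n)) : nz_minor M (\rank M).
Proof.
have full_f : row_full (rowsub (maxrankfun M) M)^T.
  by rewrite /row_full mxrank_tr; apply: maxrowsub_free.
exists (maxrankfun M), (fullrankfun full_f); apply/eqP.
rewrite -unitfE -[_ \is a _]unitmxE -unitmx_tr.
have -> : (mxsub (maxrankfun M) (fullrankfun full_f) M)^T
    = rowsub (fullrankfun full_f) (rowsub (maxrankfun M) M)^T.
  by apply/matrixP => i j; rewrite !mxE.
exact: fullrowsub_unit.
Qed.

Lemma nz_minor_le_rank m n (M : 'M[K]_(m, n)) r : nz_minor M r -> (r <= \rank M)%N.
Proof.
move=> [f [g /eqP det_neq0]].
have /mxrank_unit <- : mxsub f g M \in unitmx by rewrite unitmxE unitfE.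
rewrite mxsubrc; apply: leq_trans (mxrankS (rowsub_sub _ _)) _.
have -> : colsub g M = M *m colsub g 1%:M by rewrite mulmx_colsub mulmx1.
exact: mxrankM_maxl.
Qed.

End LinearAlgebra.

Section PolyIdeal.

Variables (L : fieldType) (T : finType) (P : T -> {poly L}).

Definition in_ideal (Q : {poly L}) : Prop := exists u : T -> {poly L}, Q = \sum_t u t * P t.

Lemma ideal_comb a b Q Q' : in_ideal Q -> in_ideal Q' -> in_ideal (a * Q + b * Q').
Proof.
move=> [u ->] [v ->]; exists (fun t => a * u t + b * v t).
rewrite !mulr_sumr -big_split; apply: eq_bigr => t _.
by rewrite mulrDl !mulrA.
Qed.

Lemma ideal_generator : exists2 g, in_ideal g & forall t, g %| P t.
Proof.
have in_P t : in_ideal (P t).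
  exists (fun t' => (t' == t)%:R); rewrite (bigD1 t) //= eqxx mul1r big1 ?addr0 //.
  by move=> t' /negPf->; rewrite mul0r.
have [g g_in g_dvd] : exists2 g, in_ideal g & forall t, t \in enum T -> g %| P t.
  elim: (enum T) => [|t s [g g_in g_dvd]].
    by exists 0 => //; exists (fun=> 0); rewrite big1 // => t _; rewrite mul0r.
  have [[u v] /= uv_gcd] := Bezoutp (P t) g.
  exists (u * P t + v * g); first exact: ideal_comb.
  move=> t'; rewrite inE (eqp_dvdl _ uv_gcd) => /predU1P[->|/g_dvd].
    exact: dvdp_gcdl.
  by apply: dvdp_trans; apply: dvdp_gcdr.
by exists g => // t; apply: g_dvd; rewrite mem_enum.
Qed.

(** All the coefficients but one can be reduced modulo a fixed nonzero
    generator, and comparing degrees bounds the remaining one. *)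
Lemma ideal_bounded D E t0 (Q : {poly L}) : (forall t, size (P t) <= D)%N -> P t0 != 0 ->
  (size Q <= E)%N -> in_ideal Q ->
  exists2 u : T -> {poly L}, Q = \sum_t u t * P t &
    forall t, (size (u t) <= D + D + E)%N.
Proof.
move=> P_D P0 Q_E [u Qu].
pose v t := if t == t0 then u t0 + \sum_(s | s != t0) (u s %/ P t0) * P s
  else u t %% P t0.
have Qv : Q = \sum_t v t * P t.
  rewrite Qu (bigD1 t0) //= [RHS](bigD1 t0) //= /v eqxx mulrDl -addrA; congr (_ + _).
  rewrite mulr_suml -big_split; apply: eq_bigr => t /negPf-> /=.
  by rewrite {1}(divp_eq (u t) (P t0)) mulrDl mulrAC.
have v_D t : t != t0 -> (size (v t) <= D)%N.
  move=> /negPf t_neq; rewrite /v t_neq; apply: leq_trans (P_D t0).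
  by rewrite ltnW // ltn_modp.
exists v => // t; have [->|t_neq] := eqVneq t t0; last first.
  by apply: leq_trans (v_D t t_neq) _; rewrite -addnA leq_addr.
have size_vP : (size (v t0 * P t0)%R <= D + D + E)%N.
  have -> : v t0 * P t0 = Q - \sum_(s | s != t0) v s * P s.
    by rewrite Qv (bigD1 t0) //= addrK.
  apply: leq_trans (size_polyD _ _) _; rewrite geq_max size_polyN.
  apply/andP; split; first by apply: leq_trans Q_E _; apply: leq_addl.
  apply: leq_trans (size_sum _ _ _) _; apply/bigmax_leqP => s s_neq.
  apply: leq_trans (size_polyMleq _ _) _; apply: leq_trans (leq_pred _) _.
  by apply: leq_trans (leq_addr E _); apply: leq_add; [apply: v_D | apply: P_D].
have [->|v_neq0] := eqVneq (v t0) 0; first by rewrite size_poly0.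
apply: leq_trans size_vP; rewrite size_mul //.
by move: P0; rewrite -size_poly_gt0; case: (size _) => // n _; rewrite addnS leq_addr.
Qed.

(** With degrees bounded, membership in an ideal becomes membership in the span
    of finitely many coefficient vectors. *)
Lemma in_ideal_span D E (Q : {poly L}) t0 : (forall t, size (P t) <= D)%N -> P t0 != 0 ->
  (size Q <= E)%N -> in_ideal Q <->
  exists a : T * 'I_(D + D + E) -> L, forall l : 'I_(D + D + E + D),
    Q`_l = \sum_x a x * ('X^(x.2) * P x.1)`_l.
Proof.
move=> P_D P0 Q_E; have sumE (a : T * 'I_(D + D + E) -> L) :
    \sum_x a x *: ('X^(x.2) * P x.1) = \sum_t (\sum_j a (t, j) *: 'X^j) * P t.
  transitivity (\sum_t \sum_(j < D + D + E) a (t, j) *: ('X^j * P t)).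
    by rewrite pair_bigA /=; apply: eq_bigr => -[].
  apply: eq_bigr => t _; rewrite mulr_suml; apply: eq_bigr => j _.
  by rewrite scalerAl.
split=> [Q_in|[a aE]]; last first.
  exists (fun t => \sum_j a (t, j) *: 'X^j); rewrite -sumE; apply/polyP => l.
  have [lt|le] := ltnP l (D + D + E + D).
    rewrite (aE (Ordinal lt)) coef_sum; apply: eq_bigr => x _.
    by rewrite coefZ.
  rewrite [LHS]nth_default; last first.
    apply: leq_trans Q_E _; apply: leq_trans le.
    by rewrite -addnA [(E + D)%N]addnC addnA leq_addl.
  rewrite nth_default //; apply: leq_trans (size_sum _ _ _) _.
  apply/bigmax_leqP => x _; apply: leq_trans (size_scale_leq _ _) _.
  apply: leq_trans (size_polyMleq _ _) _; rewrite size_polyXn addSn /=.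
  by apply: leq_trans le; apply: leq_add => //; apply: ltnW.
have [u Qu u_size] := ideal_bounded P_D P0 Q_E Q_in.
exists (fun x : T * 'I_(D + D + E) => (u x.1)`_(x.2)) => l; rewrite Qu.
rewrite (eq_bigr (fun x : T * 'I_(D + D + E) =>
  ((u x.1)`_(x.2) *: ('X^(x.2) * P x.1))`_l)); last first.
  by move=> x _; rewrite coefZ.
rewrite -coef_sum sumE !coef_sum; apply: eq_bigr => t _ /=.
have {1}-> : u t = \sum_(j < D + D + E) (u t)`_j *: 'X^j.
  apply/polyP => j; rewrite -(poly_def _ (fun j => (u t)`_j)) coef_poly.
  by case: ltnP => // le; rewrite nth_default // (leq_trans (u_size t)).
by [].
Qed.

End PolyIdeal.

Lemma meval_map_int (R : comNzRingType) n (v : 'I_n -> R) (G : {mpoly int[n]}) :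
  (map_mpoly intr G).@[v] = mmap intr v G.
Proof.
transitivity (\sum_(m <- msupp G) (G@_m)%:~R * mmap1 v m); last by [].
rewrite {1}(mpolyE G) (raddf_sum (map_mpoly intr)) !raddf_sum /=.
by apply: eq_bigr => m _; rewrite map_mpolyZ map_mpolyX mevalZ mevalX.
Qed.

Lemma mmap_comp_mpoly (R : comNzRingType) n m (v : 'I_m -> R)
    (l : n.-tuple {mpoly int[m]}) (G : {mpoly int[n]}) :
  mmap intr v (G \mPo l) = mmap intr (fun j => mmap intr v (tnth l j)) G.
Proof.
transitivity (\sum_(w <- msupp G) (G@_w)%:~R * mmap1 (fun j => mmap intr v (tnth l j)) w);
  last by [].
rewrite comp_mpolyEX raddf_sum; apply: eq_bigr => w _ /=.
rewrite mmapZ comp_mpolyX rmorph_prod; congr (_ * _).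
by apply: eq_bigr => j _; rewrite rmorphXn.
Qed.

(** * First-order definability in a ring *)

Definition sumf (A B C : Type) (f : A -> C) (g : B -> C) (x : A + B) : C :=
  match x with inl a => f a | inr b => g b end.

Section Definability.

Variable R : comNzRingType.

(** The functions given by terms of the language of rings. The variables are
    indexed by an arbitrary type, so that tuples and families of tuples can be
    used as variables directly. *)
Inductive tdef (I : Type) : ((I -> R) -> R) -> Prop :=
| tdef_var i : tdef (fun e => e i)
| tdef0 : tdef (fun=> 0)
| tdef1 : tdef (fun=> 1)
| tdefD f g : tdef f -> tdef g -> tdef (fun e => f e + g e)
| tdefN f : tdef f -> tdef (fun e => - f e)
| tdefM f g : tdef f -> tdef g -> tdef (fun e => f e * g e).

(** The predicates defined without parameters by first-order formulas of the
    language of rings, as the smallest class with the expected closure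
    properties; [fdef_ring_formula] turns them into formulas. A quantifier
    introduces the variable None. *)
Inductive fdef : forall I : Type, ((I -> R) -> Prop) -> Prop :=
| fdef_eq I f g : @tdef I f -> tdef g -> fdef (fun e => f e = g e)
| fdef_not I A : @fdef I A -> fdef (fun e => ~ A e)
| fdef_and I A B : @fdef I A -> fdef B -> fdef (fun e => A e /\ B e)
| fdef_ex I A : @fdef (option I) A -> fdef (fun e : I -> R => exists x, A (oapp e x))
| fdef_ext I A B : (forall e, A e <-> B e) -> @fdef I A -> fdef B.

Lemma tdef_subst I J (f : (I -> R) -> R) (s : I -> (J -> R) -> R) :
  tdef f -> (forall i, tdef (s i)) -> tdef (fun e => f (fun i => s i e)).
Proof. by move=> df ds; elim: df => //; constructor. Qed.

Lemma tdefX I (f : (I -> R) -> R) n : tdef f -> tdef (fun e => f e ^+ n).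
Proof.
move=> df; elim: n => [|n IHn]; first exact: tdef1.
have -> : (fun e => f e ^+ n.+1) = (fun e => f e * f e ^+ n).
  by apply: functional_extensionality => e; rewrite exprS.
exact: tdefM.
Qed.

Lemma fdef_subst I J (A : (I -> R) -> Prop) (s : I -> (J -> R) -> R) :
  fdef A -> (forall i, tdef (s i)) -> fdef (fun e => A (fun i => s i e)).
Proof.
move=> dA; elim: dA J s => {I A}.
- by move=> I f g df dg J s ds; apply: fdef_eq; apply: tdef_subst.
- by move=> I A _ IHA J s ds; apply/fdef_not/IHA.
- by move=> I A B _ IHA _ IHB J s ds; apply: fdef_and; [apply: IHA | apply: IHB].
- move=> I A _ IHA J s ds.
  pose s' o (e : option J -> R) := if o is Some i then s i (e \o Some) else e None.
  apply: (@fdef_ext _ (fun e => exists x, A (fun o => s' o (oapp e x)))).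
    move=> e; suffices E x : (fun o => s' o (oapp e x)) = oapp (fun i => s i e) x.
      by split=> [[x]|[x]]; exists x; rewrite ?E // -E.
    by apply: functional_extensionality => -[i|].
  apply: (@fdef_ex _ (fun e => A (fun o => s' o e))); apply: IHA => -[i|] /=.
    by apply: (tdef_subst (ds i)) => j; apply: tdef_var.
  exact: tdef_var.
- move=> I A B AB _ IHA J s ds; apply: fdef_ext (IHA J s ds) => e; exact: AB.
Qed.

Lemma fdef_reindex I J (A : (I -> R) -> Prop) (s : I -> J) :
  fdef A -> fdef (fun e => A (fun i => e (s i))).
Proof.
by move=> dA; apply: (fdef_subst (s := fun i e => e (s i))) => // i; apply: tdef_var.
Qed.

(** Excluded middle makes every proposition that does not depend on the
    variables equivalent to True or False. *)
Lemma fdef_const I (P : Prop) : fdef (fun=> P : Prop) (I := I).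
Proof.
have dT : @fdef I (fun=> True).
  by apply: (@fdef_ext _ (fun=> 0 = 0 :> R)) => //; apply: fdef_eq; apply: tdef0.
have [HP|HP] := classic P; first by apply: fdef_ext dT => e; tauto.
by apply: fdef_ext (fdef_not dT) => e; tauto.
Qed.

Lemma fdef_or I (A B : (I -> R) -> Prop) :
  fdef A -> fdef B -> fdef (fun e => A e \/ B e).
Proof.
move=> dA dB; apply: fdef_ext (fdef_not (fdef_and (fdef_not dA) (fdef_not dB))) => e.
by have := classic (A e); tauto.
Qed.

Lemma fdef_imp I (A B : (I -> R) -> Prop) :
  fdef A -> fdef B -> fdef (fun e => A e -> B e).
Proof.
move=> dA dB; apply: fdef_ext (fdef_or (fdef_not dA) dB) => e.
by have := classic (A e); tauto.
Qed.

Lemma fdef_iff I (A B : (I -> R) -> Prop) :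
  fdef A -> fdef B -> fdef (fun e => A e <-> B e).
Proof. by move=> dA dB; apply: fdef_and; apply: fdef_imp. Qed.

Lemma fdef_forall_fin I (T : finType) (A : T -> (I -> R) -> Prop) :
  (forall t, fdef (A t)) -> fdef (fun e => forall t, A t e).
Proof.
move=> dA; have dAs (s : seq T) : fdef (fun e => forall t, t \in s -> A t e).
  elim: s => [|t s IHs].
    by apply: fdef_ext (fdef_const I True) => e; split.
  apply: fdef_ext (fdef_and (dA t) IHs) => e; split=> [[At As] t'|As].
    by rewrite inE => /predU1P[->|/As].
  by split=> [|t' t's]; apply: As; rewrite inE ?eqxx ?t's ?orbT.
by apply: fdef_ext (dAs (enum T)) => e; split=> As t; [|move=> _]; apply: As; rewrite ?mem_enum.
Qed.

Lemma fdef_exists_fin I (T : finType) (A : T -> (I -> R) -> Prop) :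
  (forall t, fdef (A t)) -> fdef (fun e => exists t, A t e).
Proof.
move=> dA; apply: (@fdef_ext _ (fun e => ~ forall t, ~ A t e)).
  by move=> e; split=> [/not_all_not_ex|[t At] nA] //; case: (nA t).
by apply/fdef_not/fdef_forall_fin => t; apply: fdef_not.
Qed.

Lemma fdef_exists_fun I (J : finType) (A : (I + J -> R) -> Prop) :
  fdef A -> fdef (fun e => exists g, A (sumf e g)).
Proof.
suffices ordP n I' (B : (I' + 'I_n -> R) -> Prop) :
    fdef B -> fdef (fun e => exists g, B (sumf e g)).
  move=> dA; pose s (x : I + J) : I + 'I_#|J| :=
    match x with inl i => inl i | inr j => inr (enum_rank j) end.
  apply: fdef_ext (ordP _ _ _ (fdef_reindex s dA)) => e; split=> [[g Ag]|[g Ag]].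
    exists (g \o enum_rank); congr (A _): Ag.
    by apply: functional_extensionality => -[].
  exists (g \o enum_val); congr (A _): Ag.
  by apply: functional_extensionality => -[] //= j; rewrite enum_rankK.
elim: n I' B => [|n IHn] I' B dB.
  pose s (x : I' + 'I_0) := match x with inl i => i | inr k => False_rect I' (notF (valP k)) end.
  apply: fdef_ext (fdef_reindex s dB) => e; split=> [Be|[g Bg]].
    exists (fun k : 'I_0 => False_rect R (notF (valP k))); congr (B _): Be.
    by apply: functional_extensionality => -[i|[]].
  by congr (B _): Bg; apply: functional_extensionality => -[i|[]].
(* The first of the n + 1 values becomes the variable bound by one quantifier. *)
pose s (x : I' + 'I_n.+1) : option I' + 'I_n :=
  match x with
  | inl i => inl (Some i)
  | inr k => if unlift ord0 k is Some j then inr j else inl None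
  end.
apply: fdef_ext (fdef_ex (IHn _ _ (fdef_reindex s dB))) => e.
have E x g : (fun i => sumf (oapp e x) g (s i)) = sumf e (cons_fun x g).
  apply: functional_extensionality => -[i|k] //=; rewrite /cons_fun.
  by case: (unlift ord0 k).
split=> [[x [g]]|[g]]; first by rewrite E; exists (cons_fun x g).
move=> Bg; exists (g ord0), (fun j => g (lift ord0 j)); rewrite E.
congr (B (sumf e _)): Bg; apply: functional_extensionality => k.
by rewrite /cons_fun; case: (unliftP ord0 k) => [j|] ->.
Qed.

Lemma fdef_forall_fun I (J : finType) (A : (I + J -> R) -> Prop) :
  fdef A -> fdef (fun e => forall g, A (sumf e g)).
Proof.
move=> dA; apply: fdef_ext (fdef_not (fdef_exists_fun (fdef_not dA))) => e.
by split=> [/not_ex_not_all|Ag [g]] //; case.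
Qed.

Lemma tdef_ring_term I (f : (I -> R) -> R) n (r : I -> 'I_n) : tdef f ->
  exists t : ring_term n, forall a, ring_eval a t = f (fun i => tnth a (r i)).
Proof.
elim=> {f} [i|||f g _ [t tE] _ [u uE]|f _ [t tE]|f g _ [t tE] _ [u uE]].
- by exists (RVar (r i)).
- by exists (RZero n).
- by exists (ROne n).
- by exists (RAdd t u) => a /=; rewrite tE uE.
- by exists (ROpp t) => a /=; rewrite tE.
- by exists (RMul t u) => a /=; rewrite tE uE.
Qed.

Lemma fdef_ring_formula I (A : (I -> R) -> Prop) n (r : I -> 'I_n) : fdef A ->
  exists f : ring_formula n, forall a, ring_holds a f <-> A (fun i => tnth a (r i)).
Proof.
move=> dA; elim: dA n r => {I A}.
- move=> I f g df dg n r; have [t tE] := tdef_ring_term r df.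
  have [u uE] := tdef_ring_term r dg.
  by exists (REq t u) => a /=; rewrite tE uE.
- by move=> I A _ IHA n r; have [f fE] := IHA n r; exists (RNot f) => a /=; rewrite fE.
- move=> I A B _ IHA _ IHB n r; have [f fE] := IHA n r; have [g gE] := IHB n r.
  by exists (RAnd f g) => a /=; rewrite fE gE.
- move=> I A _ IHA n r; have [f fE] := IHA n.+1 (oapp (lift ord0 \o r) ord0).
  exists (RExists f) => a /=.
  suffices E x : (fun o => tnth [tuple of x :: a] (oapp (lift ord0 \o r) ord0 o))
      = oapp (fun i => tnth a (r i)) x.
    by split=> [[x]|[x Ax]]; [rewrite fE E; exists x | exists x; rewrite fE E].
  apply: functional_extensionality => -[i|] /=; last by rewrite (tnth_nth 0).
  by rewrite !(tnth_nth 0).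
- move=> I A B AB _ IHA n r; have [f fE] := IHA n r; exists f => a.
  by rewrite fE AB.
Qed.

End Definability.

(** * Generic characters: linear relations between values *)

Section Character.

Variables (F K : closedFieldType) (chi : F -> K).
Hypotheses (charK : [pchar K] =i pred0) (chi_char : is_character chi).
Hypothesis chi_gen : is_generic chi.
Variable p : nat.
Hypotheses (p_prime_or_0 : prime p \/ p = 0%N) (charF : has_char F p).

Lemma chiM : {morph chi : a b / a * b}. Proof. by case: chi_char. Qed.
Lemma chi0 : chi 0 = 0. Proof. by case: chi_char. Qed.
Lemma chi1 : chi 1 = 1. Proof. by case: chi_char. Qed.
Lemma chi_inj : injective chi. Proof. by case: chi_gen. Qed.

Lemma chi_eq0 a : (chi a == 0) = (a == 0).
Proof. by rewrite -chi0 (inj_eq chi_inj). Qed.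

Lemma chiX n : {morph chi : a / a ^+ n}.
Proof. by move=> a; elim: n => [|n IHn]; rewrite ?chi1 // !exprS chiM IHn. Qed.

Lemma chi_prod (I : Type) (r : seq I) (P : pred I) (G : I -> F) :
  chi (\prod_(i <- r | P i) G i) = \prod_(i <- r | P i) chi (G i).
Proof. exact: (big_morph chi chiM chi1). Qed.

Lemma chi_monomial (I : finType) (a : I -> F) k :
  chi (monomial_at a k) = monomial_at (chi \o a) k.
Proof. by rewrite chi_prod; apply: eq_bigr => i _; rewrite chiX. Qed.

Lemma chi_prim_root n w : n.-primitive_root w -> n.-primitive_root (chi w).
Proof.
case/andP => n_gt0 /forallP prim_w; apply/andP; split=> //; apply/forallP => i.
by rewrite unity_rootE -chiX -chi1 (inj_eq chi_inj) -unity_rootE.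
Qed.

Lemma generic_int_independent r (b : 'I_r -> F) (G : {mpoly int[r]}) :
  mult_free b -> mmap intr (chi \o b) G = 0 -> G = 0.
Proof.
case: r b G => [|r] b G free_b Gb0.
  move: Gb0; rewrite -(mpolyKC G) mmapC /= => /eqP.
  by rewrite intr_eq0_char0 // => /eqP->; rewrite rmorph0.
have charKF : [pchar {fraction K}] =i pred0.
  apply/pcharf0P => n; rewrite -(rmorph_nat (@tofrac K)) tofrac_eq0.
  by move/pcharf0P: charK => ->.
have [_ /(_ _ _ (ltn0Sn r) (mult_free_independent free_b)) indep] := chi_gen.
have := indep (map_mpoly intr G); set v := tnth _ => indep0.
have {}indep0 : map_mpoly intr G = 0 :> {mpoly {fraction K}[r.+1]}.
  apply: indep0 => [m|].
    rewrite mcoeff_map_mpoly => S [S1 SB _] /=.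
    have S0 : 0 \in S by rewrite -(subrr 1) SB.
    have SN x : x \in S -> - x \in S by move=> Sx; rewrite -sub0r SB.
    have Snat n : n%:R \in S.
      by elim: n => // n Sn; rewrite -addn1 natrD -[1%:R]opprK SB // SN.
    by case: (G@_m) => n; rewrite ?NegzE ?rmorphN; [|apply: SN]; apply: Snat.
  have -> : (map_mpoly intr G).@[v] = tofrac (mmap intr (chi \o b) G).
    transitivity (tofrac (\sum_(m <- msupp G) (G@_m)%:~R * mmap1 (chi \o b) m)).
      2: by [].
    rewrite {1}(mpolyE G) (raddf_sum (map_mpoly intr)) !raddf_sum /=.
    apply: eq_bigr => m _; rewrite map_mpolyZ map_mpolyX mevalZ mevalX.
    rewrite rmorphM rmorph_int rmorph_prod; congr (_ * _).
    by apply: eq_bigr => i _; rewrite /v tnth_map tnth_mktuple /= rmorphXn.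
  by rewrite Gb0 rmorph0.
apply/mpolyP => m; have := congr1 (mcoeff m) indep0.
rewrite mcoeff_map_mpoly !mcoeff0 => /eqP.
by rewrite intr_eq0_char0 // => /eqP.
Qed.

Lemma char0_prim_root_exists n : (0 < n)%N -> exists w : K, n.-primitive_root w.
Proof.
move=> n_gt0; apply: closed_prim_root_exists.
by move/pcharf0P: charK => ->; rewrite -lt0n.
Qed.

Lemma chi_unity_root n (w : K) a : n.-primitive_root w -> a ^+ n = 1 ->
  exists k : 'I_n, chi a = w ^+ k.
Proof.
move=> prim_w an1; have /(prim_rootP prim_w) [k ->] : chi a ^+ n = 1.
  by rewrite -chiX an1 chi1.
by exists k.
Qed.

(** In a multiplicative basis a of L-th roots for the nonzero u_i, every u_i is,
    up to a common factor, a root of unity times a monomial in a. The values of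
    chi on a are algebraically independent even over the roots of unity, so the
    terms with the same monomial have sum zero; these are the terms with the
    same L-th power. *)
Lemma vanishing_sum_torsion (T : finType) (c : T -> int) (u : T -> F) :
  \sum_i (c i)%:~R * chi (u i) = 0 ->
  exists2 L, (0 < L)%N & forall j, u j != 0 ->
    \sum_(i | u i ^+ L == u j ^+ L) (c i)%:~R * chi (u i) = 0.
Proof.
move=> sum0; pose s := [seq u i | i <- enum T & u i != 0].
have s_neq0 : 0 \notin s.
  apply/mapP => [[i]]; rewrite mem_filter => /andP[ui _] ui0.
  by rewrite -ui0 eqxx in ui.
have [r [b [L [free_b L_gt0 b_s]]]] := mult_basis s_neq0; exists L => //.
have /fin_all_exists[kl kl_u] (i : T) : exists kl : ('I_r -> nat) * ('I_r -> nat),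
    u i != 0 -> u i ^+ L * monomial_at b kl.2 = monomial_at b kl.1.
  have [ui0|ui_neq0] := eqVneq (u i) 0; first by exists (fun=> 0%N, fun=> 0%N).
  have [|k [l kl]] := b_s (u i); last by exists (k, l).
  by apply: map_f; rewrite mem_filter ui_neq0 mem_enum.
have /fin_all_exists[a aL] (i : 'I_r) : exists x, x ^+ L = b i.
  exact: closed_nth_root_exists.
have bE k : monomial_at b k = monomial_at a k ^+ L.
  by rewrite -monomial_at_expX; apply: eq_bigr => i _; rewrite aL.
have free_a : mult_free a.
  by move=> k l eq_kl; apply: free_b; rewrite !bE eq_kl.
have mon_neq0 k : monomial_at a k != 0.
  apply/prodf_neq0 => i _; apply: expf_neq0; apply/eqP => ai0.
  have mon0 n : monomial_at a (fun j => (j == i) * n.+1)%N = 0.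
    by rewrite /monomial_at (bigD1 i) //= eqxx ai0 mul1n expr0n mul0r.
  have /free_a/(_ i) := etrans (mon0 0%N) (esym (mon0 1%N)).
  by rewrite eqxx.
(* The factor la clears the negative exponents in the relations for all the u i. *)
pose la := monomial_at a (fun j => \sum_i (kl i).2 j)%N.
pose k i := [multinom (kl i).1 j + \sum_(i' | i' != i) (kl i').2 j | j < r]%N.
have la_u i : u i != 0 -> (la * u i) ^+ L = monomial_at a (k i) ^+ L.
  move=> ui_neq0; rewrite -bE exprMn -bE monomial_at_sum (bigD1 i) //=.
  rewrite mulrC mulrA kl_u // -monomial_at_sum -monomial_atD.
  by apply: eq_bigr => j _; rewrite mnmE.
have [w prim_w] := char0_prim_root_exists L_gt0.
have /fin_all_exists[h hE] (i : T) : exists h : 'I_L, u i != 0 ->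
    chi la * chi (u i) = w ^+ h * mmap1 (chi \o a) (k i).
  have [ui0|ui_neq0] := eqVneq (u i) 0; first by exists (Ordinal L_gt0).
  have [|h hE] := @chi_unity_root L w (la * u i / monomial_at a (k i)) prim_w.
    by rewrite expr_div_n la_u // divff // expf_neq0.
  exists h => _; rewrite -hE -[mmap1 _ _]/(monomial_at (chi \o a) (k i)).
  by rewrite -chi_monomial -!chiM divfK.
have a_ind := fun G => generic_int_independent (G := G) free_a.
have := monomial_relation_split charK (P := fun i => u i != 0) (c := c)
  (h := h) (k := k) a_ind prim_w.
have -> : \sum_(i | u i != 0) (c i)%:~R * w ^+ h i * mmap1 (chi \o a) (k i) = 0.
  transitivity (chi la * \sum_i (c i)%:~R * chi (u i)).
    2: by rewrite sum0 mulr0.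
  rewrite mulr_sumr big_mkcond /=.
  apply: eq_bigr => i _; case: eqVneq => [->|ui_neq0]; first by rewrite chi0 !mulr0.
  by rewrite mulrCA hE // mulrA.
move=> /(_ erefl) split0 j uj_neq0.
have la_neq0 : chi la != 0 by rewrite chi_eq0 mon_neq0.
apply: (mulfI la_neq0); rewrite mulr0 mulr_sumr.
transitivity ((\sum_(i | (u i != 0) && (k i == k j)) (c i)%:~R * w ^+ h i)
    * mmap1 (chi \o a) (k j)); last by rewrite split0 mul0r.
rewrite mulr_suml; apply: eq_big => [i|i eq_ij].
  have [ui0|ui_neq0] := eqVneq (u i) 0.
    by rewrite ui0 expr0n gtn_eqF //= eq_sym expf_eq0 (negPf uj_neq0) andbF.
  rewrite -(inj_eq (mulfI (expf_neq0 L (mon_neq0 (fun j => \sum_i (kl i).2 j)%N)))).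
  rewrite -!exprMn !la_u // -!bE /=; apply/eqP/eqP => [/free_b eq_k|-> //].
  exact/mnmP.
have ui_neq0 : u i != 0.
  apply: contraTneq eq_ij => ->; rewrite expr0n gtn_eqF //= eq_sym expf_eq0.
  by rewrite (negPf uj_neq0) andbF.
rewrite mulrCA hE // mulrA; congr (_ * mmap1 _ _); apply/mnmP/free_b.
by rewrite !bE -!la_u // !exprMn (eqP eq_ij).
Qed.

(** The order L allowed in [vanishing_sum_torsion] can be lowered by a prime q
    whenever q^2 divides L or q exceeds the number of terms. If no such q is
    left then L divides the factorial of the number of terms. *)
Lemma vanishing_sum_classes (T : finType) (c : T -> int) (u : T -> F) :
  \sum_i (c i)%:~R * chi (u i) = 0 ->
  forall j, u j != 0 ->
    \sum_(i | u i ^+ #|T|`! == u j ^+ #|T|`!) (c i)%:~R * chi (u i) = 0.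
Proof.
move=> sum0; have [L L_gt0] := vanishing_sum_torsion sum0.
elim/ltn_ind: L L_gt0 => L IHL L_gt0 L_good.
have [L_M | /negP L_M] := boolP (L %| #|T|`!)%N.
  move=> j uj_neq0; apply: (@sum_by_classes _ _ _ _ (fun i => u i ^+ L)).
  move=> i /eqP eq_ij; have ui_neq0 : u i != 0.
    apply: contraTneq (expf_neq0 #|T|`! uj_neq0) => ui0.
    by rewrite -eq_ij ui0 expr0n gtn_eqF ?fact_gt0 // eqxx.
  rewrite -[RHS](L_good i ui_neq0); apply: eq_bigl => i' /=.
  case: (altP (u i' ^+ L =P _)) => [eq_L|_]; last by rewrite andbF.
  by rewrite andbT -eq_ij -(divnK L_M) mulnC !exprM eq_L eqxx.
have [q q_pr [q_L q_small]] : exists2 q, prime q & (q %| L)%N /\ ((q * q %| L) || (#|T| < q))%N.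
  have /existsP [q /andP[]] : [exists q : 'I_L.+1, ((q : nat) \in primes L)
      && (logn q #|T|`! < logn q L)%N].
    apply: contra_notT L_M => /existsPn L_log; apply/dvdn_partP => // q q_L.
    have := q_L; rewrite mem_primes => /and3P[q_pr _ q_dL].
    have lt_q : (q < L.+1)%N by rewrite ltnS dvdn_leq.
    have := L_log (Ordinal lt_q); rewrite q_L /= -leqNgt => le_log.
    by rewrite p_part pfactor_dvdn ?fact_gt0.
  rewrite mem_primes => /and3P[q_pr _ q_L] log_q; exists (q : nat) => //; split=> //.
  have [_|le_qT] := ltnP #|T| q; first by rewrite orbT.
  rewrite orbF -[(q * q)%N]/(q ^ 2)%N pfactor_dvdn //.
  apply: leq_trans log_q; rewrite ltnS -pfactor_dvdn ?fact_gt0 // expn1.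
  by rewrite dvdn_fact // prime_gt0.
have q_gt0 := prime_gt0 q_pr.
have LE := divnK q_L; set N := (L %/ q)%N in LE.
have N_gt0 : (0 < N)%N by rewrite divn_gt0 // dvdn_leq.
apply: (IHL N) => //; first by rewrite -LE ltn_Pmulr // prime_gt1.
move=> j uj_neq0; have chi_uj_neq0 : chi (u j) != 0 by rewrite chi_eq0.
have [w prim_w] := char0_prim_root_exists L_gt0.
pose A i := u i ^+ L == u j ^+ L.
have /fin_all_exists[k kE] (i : T) :
    exists k : 'I_L, A i -> chi (u i) = chi (u j) * w ^+ k.
  have [/eqP Ai|NAi] := boolP (A i); last by exists (Ordinal L_gt0).
  have [|k kE] := @chi_unity_root L w (u i / u j) prim_w.
    by rewrite expr_div_n Ai divff // expf_neq0.
  by exists k => _; rewrite -kE -chiM mulrC divfK.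
have sumA : \sum_(i | A i) (c i)%:~R * w ^+ k i = 0.
  apply: (mulfI chi_uj_neq0); rewrite mulr0 mulr_sumr -[RHS](L_good j uj_neq0).
  by apply: eq_bigr => i Ai; rewrite (kE i Ai) mulrCA.
have := vanishing_sum_dvd charK prim_w q_pr q_L q_small sumA.
move/(congr1 ( *%R (chi (u j)))); rewrite mulr0 mulr_sumr => eq0; rewrite -[RHS]eq0 {eq0}.
apply: eq_big => [i|i].
  case Ai: (A i) => /=; last first.
    by apply: contraFF Ai => /eqP uN; rewrite /A -LE !exprM uN.
  rewrite -(inj_eq chi_inj) !chiX (kE i Ai) exprMn -[X in _ == X]mulr1.
  rewrite (inj_eq (mulfI (expf_neq0 N chi_uj_neq0))) -exprM.
  by rewrite -(prim_order_dvd prim_w) -[X in (X %| _)%N]LE mulnC dvdn_pmul2r.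
move=> uN; have Ai : A i by rewrite /A -LE !exprM (eqP uN).
by rewrite (kE i Ai) mulrCA.
Qed.

(** In characteristic p there are no roots of unity of order p, so e is the
    prime-to-p part of n; in characteristic zero it is n. *)
Lemma unity_roots_cyclic n : (0 < n)%N ->
  exists2 e, exists w : F, e.-primitive_root w &
    forall x : F, x ^+ n = 1 -> x ^+ e = 1.
Proof.
move=> n_gt0; move: charF; rewrite /has_char; case: p p_prime_or_0 => [_|p' pr_p] charFp.
  exists n => //; apply: closed_prim_root_exists.
  by move/pcharf0P: charFp => ->; rewrite -lt0n.
have {pr_p} p_pr : prime p'.+1 by case: pr_p.
exists (n`_(p'.+1)^')%N.
  apply: closed_prim_root_exists; rewrite -(dvdn_pcharf charFp) -p'natE //.
  exact: part_pnat.
have expp1 a (y : F) : y ^+ (p'.+1 ^ a) = 1 -> y = 1.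
  elim: a y => [|a IHa] y; first by rewrite expn0 expr1.
  rewrite expnSr exprM => yp1; apply: IHa.
  apply: (fmorph_inj (pFrobenius_aut charFp)).
  by rewrite rmorph1 /= pFrobenius_autE.
move=> x xn1; apply: (expp1 (logn p'.+1 n)).
by rewrite -exprM -p_part mulnC partnC.
Qed.

(** The value prescribed for a coordinate by the linear subspace with label v:
    a power of w times another coordinate, or zero. *)
Definition lin_value (R : pzRingType) (T : finType) e (w : R) (u : T -> R)
    (v : option (T * 'I_e)) : R :=
  if v is Some (b, k) then u b * w ^+ k else 0.

(** By [vanishing_sum_classes] every solution u consists of zeros and of
    multiples, by powers of w, of one chosen coordinate in each class. A pattern
    t of this kind contributes a subspace of solutions when its coefficients
    satisfy a vanishing condition on powers of chi w, and by conjugation this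
    condition is the same for all primitive roots w. *)
Lemma vanishing_sum_linear (T : finType) (c : T -> int) :
  exists e (good : {set {ffun T -> option (T * 'I_e)}}),
    (exists w : F, e.-primitive_root w) /\
    forall w : F, e.-primitive_root w -> forall u,
      \sum_i (c i)%:~R * chi (u i) = 0 <->
      exists2 t, t \in good & forall i, u i = lin_value w u (t i).
Proof.
have [e [w0 prim_w0] e_all] := unity_roots_cyclic (fact_gt0 #|T|).
pose g (w : K) (t : {ffun T -> option (T * 'I_e)}) b i : K :=
  if t i is Some (b', k) then (b' == b)%:R * w ^+ k else 0.
exists e, [set t | [forall b, \sum_i (c i)%:~R * g (chi w0) t b i == 0]].
split; first by exists w0.
move=> w prim_w u; split=> [sum0|[t]]; last first.
  rewrite inE => /forallP t_good t_u.
  have {}t_good b : \sum_i (c i)%:~R * g (chi w) t b i = 0.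
    pose f : {poly int} := \sum_i
      c i *: (if t i is Some (b', k) then (b' == b)%:R * 'X^k else 0).
    have f_val x : (map_poly intr f).[x] = \sum_i (c i)%:~R * g x t b i.
      rewrite rmorph_sum horner_sum; apply: eq_bigr => i _ /=.
      rewrite map_polyZ hornerZ /g /=; congr (_ * _).
      case: (t i) => [[b' k]|]; last by rewrite rmorph0 horner0.
      rewrite rmorphM rmorph_nat /= map_polyXn hornerM hornerXn; congr (_ * _).
      by rewrite -polyC_natr hornerC.
    have := primitive_root_conj charK (f := f) (chi_prim_root prim_w0)
      (chi_prim_root prim_w).
    by rewrite !rootE !f_val t_good => /(_ isT)/eqP.
  have chi_u i : chi (u i) = \sum_b chi (u b) * g (chi w) t b i.
    rewrite {1}t_u /lin_value /g; case: (t i) => [[b' k]|]; last first.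
      by rewrite chi0 big1 // => b _; rewrite mulr0.
    rewrite (bigD1 b') //= eqxx mul1r chiM chiX big1 ?addr0 // => b b_neq.
    by rewrite eq_sym (negPf b_neq) mul0r mulr0.
  under eq_bigr do rewrite chi_u mulr_sumr.
  rewrite exchange_big big1 //= => b _; under eq_bigr do rewrite mulrCA.
  by rewrite -mulr_sumr t_good mulr0.
pose M := #|T|`!; have M_gt0 : (0 < M)%N by apply: fact_gt0.
have expM0 (x : F) : (x ^+ M == 0) = (x == 0) by rewrite expf_eq0 M_gt0.
pose h i := odflt i [pick j | u j ^+ M == u i ^+ M].
have hM i : u (h i) ^+ M = u i ^+ M.
  by rewrite /h; case: pickP => //= j /eqP.
have h_eq i j : u i ^+ M = u j ^+ M -> h i = h j.
  rewrite /h => ->; case: pickP => //= /(_ j).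
  by rewrite eqxx.
have h0 i : u i != 0 -> u (h i) != 0.
  by move=> ui_neq0; rewrite -expM0 hM expM0.
have e_h i : u i != 0 -> (u i / u (h i)) ^+ e = 1.
  by move=> ui_neq0; rewrite e_all // expr_div_n -/M -hM divff // expf_neq0 ?h0.
have /fin_all_exists[k kE] (i : T) :
    exists k : 'I_e, u i != 0 -> u i = u (h i) * w ^+ k.
  have [ui0|ui_neq0] := eqVneq (u i) 0.
    by exists (Ordinal (prim_order_gt0 prim_w)).
  have [k kE] := prim_rootP prim_w (e_h i ui_neq0).
  by exists k => _; rewrite -kE mulrC divfK ?h0.
pose t := [ffun i => if u i == 0 then None else Some (h i, k i)].
exists t => [|i]; last first.
  by rewrite ffunE /lin_value; case: eqVneq => // /kE.
rewrite inE; apply/forallP => b.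
have f_b x : \sum_i (c i)%:~R * g x t b i =
    \sum_(i | (u i != 0) && (h i == b)) (c i)%:~R * x ^+ k i.
  rewrite [RHS]big_mkcond; apply: eq_bigr => i _; rewrite /g ffunE.
  case: eqVneq => _ /=; first by rewrite mulr0.
  by case: (h i == b); rewrite ?mul1r // mul0r mulr0.
suffices sum_b : \sum_i (c i)%:~R * g (chi w) t b i = 0.
  pose f : {poly int} := \sum_(i | (u i != 0) && (h i == b)) c i *: 'X^(k i).
  have f_val x : (map_poly intr f).[x] = \sum_i (c i)%:~R * g x t b i.
    rewrite rmorph_sum horner_sum f_b; apply: eq_bigr => i _ /=.
    by rewrite map_polyZ /= map_polyXn hornerZ hornerXn.
  have := primitive_root_conj charK (f := f) (chi_prim_root prim_w)
    (chi_prim_root prim_w0).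
  by rewrite !rootE !f_val sum_b => /(_ (eqxx _)).
rewrite f_b; have [i0 /andP[ui0 /eqP hi0]|no_i] :=
  pickP (fun i => (u i != 0) && (h i == b)); last by rewrite big_pred0.
have ub_neq0 : u b != 0 by rewrite -hi0 h0.
have chi_ub : chi (u b) != 0 by rewrite chi_eq0.
apply: (mulfI chi_ub); rewrite mulr0 mulr_sumr.
rewrite -[RHS](vanishing_sum_classes sum0 ub_neq0) -/M; apply: eq_big => i.
  apply/andP/eqP => [[_ /eqP<-]|eq_ib]; first by rewrite hM.
  have ui_neq0 : u i != 0.
    by rewrite -expM0 eq_ib expM0.
  by split=> //; rewrite -hi0; apply/eqP/h_eq; rewrite eq_ib -hi0 hM.
by case/andP => ui_neq0 /eqP hi; rewrite [in RHS]kE // hi chiM chiX mulrCA.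
Qed.

Lemma eventually_nonroot (P : {poly K}) : P != 0 ->
  exists B, forall m, (B <= m)%N -> ~~ root P m%:R.
Proof.
move=> P_neq0; have [rs DP] := closed_field_poly_normal P.
have [B B_rs] : exists B, forall m, (B <= m)%N -> m%:R \notin rs.
  elim: rs {DP} => [|z rs [B B_rs]]; first by exists 0%N.
  have [[n ->]|no_n] := classic (exists n, z = n%:R); last first.
    exists B => m /B_rs m_rs; rewrite inE negb_or m_rs andbT.
    by apply/eqP => zm; apply: no_n; exists m.
  exists (maxn B n.+1) => m; rewrite geq_max inE negb_or => /andP[/B_rs-> lt_nm].
  rewrite andbT -subr_eq0 -natrB ?(ltnW lt_nm) //.
  by move/pcharf0P: charK => ->; rewrite subn_eq0 -ltnNge.
exists B => m /B_rs; rewrite DP rootZ ?lead_coef_eq0 //.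
by rewrite root_prod_XsubC.
Qed.

(** Restricted to a class, the sum is the value at m of a polynomial with
    coefficients from a finite set depending only on c, because the quotients of
    the chi(u_i) in a class are roots of unity of bounded order. For large m this
    value is zero only if the polynomial is zero. *)
Lemma vanishing_sum_large_base (T : finType) (c : T -> int) (d : T -> nat) :
  exists B, forall m : nat, (B <= m)%N -> forall u,
    \sum_i (c i * m%:Z ^+ d i)%:~R * chi (u i) = 0 ->
    forall n, \sum_(i | d i == n) (c i)%:~R * chi (u i) = 0.
Proof.
pose M := #|T|`!; have M_gt0 : (0 < M)%N by apply: fact_gt0.
have [w prim_w] := char0_prim_root_exists M_gt0.
pose P (x : {set T} * {ffun T -> 'I_M}) : {poly K} :=
  \sum_(i in x.1) ((c i)%:~R * w ^+ x.2 i) *: 'X^(d i).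
have /fin_all_exists[B BP] x :
    exists B, forall m, (B <= m)%N -> root (P x) m%:R -> P x = 0.
  have [->|/eventually_nonroot[B B_P]] := eqVneq (P x) 0; first by exists 0%N.
  by exists B => m /B_P/negPf->.
exists (\max_x B x) => m le_Bm u sum0 n.
transitivity (\sum_(i | (d i == n) && (u i != 0)) (c i)%:~R * chi (u i)).
  rewrite [RHS]big_mkcondr; apply: eq_bigr => i _.
  by case: eqVneq => //= ->; rewrite chi0 mulr0.
apply: (@sum_by_classes _ _ _ _ (fun i => u i ^+ M)) => j /andP[_ uj_neq0].
have chi_uj : chi (u j) != 0 by rewrite chi_eq0.
have /fin_all_exists[h hE] (i : T) :
    exists h : 'I_M, u i ^+ M == u j ^+ M -> chi (u i) = chi (u j) * w ^+ h.
  have [eq_ij|neq_ij] := boolP (_ == _); last by exists (Ordinal M_gt0).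
  have [|h hE] := @chi_unity_root M w (u i / u j) prim_w.
    by rewrite expr_div_n (eqP eq_ij) divff // expf_neq0.
  by exists h => _; rewrite -hE -chiM mulrC divfK.
pose x := ([set i | u i ^+ M == u j ^+ M], [ffun i => h i]).
have P0 : P x = 0.
  apply: (BP x m); first by apply: leq_trans le_Bm; apply: leq_bigmax.
  rewrite rootE horner_sum; apply/eqP/(mulfI chi_uj).
  rewrite mulr0 mulr_sumr -[RHS](vanishing_sum_classes sum0 uj_neq0).
  apply: eq_big => i; rewrite inE // => /hE-> /=.
  rewrite hornerZ hornerXn ffunE rmorphM rmorphXn /= -[m%:~R]/m%:R.
  by rewrite mulrCA -!mulrA; congr (_ * _); rewrite mulrC mulrCA mulrA.
have := congr1 (fun q : {poly K} => chi (u j) * q`_n) P0.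
rewrite coef0 mulr0 coef_sum mulr_sumr => coef_n0; rewrite -[RHS]coef_n0.
rewrite big_mkcond [RHS]big_mkcond; apply: eq_bigr => i _; rewrite inE /=.
rewrite coefZ coefXn ffunE [n == _]eq_sym.
case: (altP (u i ^+ M =P _)) => [/eqP eq_ij|_]; last by rewrite andbF.
have -> : u i != 0.
  by rewrite -[u i == 0]/(true && _) -M_gt0 -expf_eq0 (eqP eq_ij) expf_neq0.
by rewrite !andbT; case: eqP; rewrite ?mulr0 // mulr1 hE // mulrCA.
Qed.

(** The solution set is a union of subspaces with equations over Z[w]. If u lies
    outside, the product Q of one equation for each subspace, violated by u, is
    a polynomial in w, and it vanishes on the solution set for every primitive
    w. After reduction modulo the cyclotomic polynomial Q has fewer terms in w
    than there are primitive roots, so all its coefficients vanish on the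
    solution set, while some coefficient does not vanish at u. These
    coefficients are integral polynomials. *)
Lemma vanishing_sum_separation n (c : 'I_n -> int) (u : 'I_n -> F) :
  \sum_i (c i)%:~R * chi (u i) != 0 ->
  exists2 G : {mpoly int[n]}, mmap intr u G != 0 &
    forall v : 'I_n -> F, \sum_i (c i)%:~R * chi (v i) = 0 -> mmap intr v G = 0.
Proof.
move=> sum_neq0; have [e [good [[w prim_w] goodP]]] := vanishing_sum_linear c.
pose A := {mpoly int[n]}.
pose ev (x : F) (v : 'I_n -> F) (P : {poly A}) := (map_poly (mmap intr v) P).[x].
have evM x v : {morph ev x v : P Q / P * Q}.
  by move=> P Q; rewrite /ev rmorphM hornerM.
have /fin_all_exists[l lP] (t : {ffun 'I_n -> option ('I_n * 'I_e)}) :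
    exists l, t \in good -> ev w u l != 0 /\
      forall x v, (forall i, v i = lin_value x v (t i)) -> ev x v l = 0.
  have [t_good|t_bad] := boolP (t \in good); last by exists 0.
  have [i /eqP ui] : exists i, u i <> lin_value w u (t i).
    apply: not_all_ex_not => u_t; case/eqP: sum_neq0.
    by apply/(goodP w prim_w); exists t.
  exists (('X_i)%:P - if t i is Some (b, k) then ('X_b)%:P * 'X^k else 0) => _.
  have evE x v : ev x v (('X_i)%:P
      - if t i is Some (b, k) then ('X_b)%:P * 'X^k else 0) = v i - lin_value x v (t i).
    rewrite /ev rmorphB /= map_polyC hornerD hornerN hornerC /= mmapX mmap1U.
    congr (_ - _); rewrite /lin_value; case: (t i) => [[b k]|].
      by rewrite rmorphM /= map_polyC map_polyXn hornerM hornerC hornerXn /= mmapX mmap1U.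
    by rewrite rmorph0 horner0.
  split=> [|x v vE]; first by rewrite evE subr_eq0.
  by rewrite evE -vE subrr.
pose Q := \prod_(t in good) l t.
have Q_u : ev w u Q != 0.
  rewrite (big_morph _ (evM w u) (_ : _ = 1)); last by rewrite /ev rmorph1 hornerC.
  by apply/prodf_neq0 => t /lP[].
have Q_v x v : e.-primitive_root x -> \sum_i (c i)%:~R * chi (v i) = 0 -> ev x v Q = 0.
  move=> prim_x /(goodP x prim_x)[t t_good v_t].
  by rewrite /Q (bigD1 t) //= evM (lP t t_good).2 // mul0r.
pose Phi : {poly A} := map_poly intr 'Phi_e.
have Phi_monic : Phi \is monic by apply: monic_map; apply: Cyclotomic_monic.
have size_Phi : size Phi = (totient e).+1.
  rewrite -size_Cyclotomic; apply: size_map_poly_id0.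
  by rewrite (monicP (Cyclotomic_monic e)) rmorph1 oner_eq0.
have Phi_ev x v : e.-primitive_root x -> ev x v Phi = 0.
  move=> prim_x; rewrite /ev /Phi -map_poly_comp.
  rewrite (@eq_map_poly _ _ _ intr); last by move=> z /=; rewrite rmorph_int.
  exact/eqP/Cyclotomic_root.
pose r := Pdiv.Ring.rmodp Q Phi.
have r_ev x v : e.-primitive_root x -> ev x v r = ev x v Q.
  move=> prim_x; rewrite [in RHS](Pdiv.RingMonic.rdivp_eq Phi_monic Q) /ev rmorphD hornerD.
  by rewrite -![(map_poly _ _).[x]]/(ev x v _) evM Phi_ev // mulr0 add0r.
have size_r : (size r <= totient e)%N.
  by rewrite -ltnS -size_Phi Pdiv.Ring.ltn_rmodp monic_neq0.
have [j rj] : exists j, mmap intr u r`_j <> 0.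
  apply: not_all_ex_not => r0; case/eqP: Q_u; rewrite -r_ev // /ev.
  suffices -> : map_poly (mmap intr u) r = 0 by rewrite horner0.
  by apply/polyP => j; rewrite coef_map coef0 /= r0.
exists r`_j; first exact/eqP.
move=> v sum_v; rewrite -[LHS](coef_map (mmap intr v)).
suffices -> : map_poly (mmap intr v) r = 0 by rewrite coef0.
have [rs [uniq_rs size_rs rs_prim]] := primitive_roots_seq prim_w.
have all_rs : all (root (map_poly (mmap intr v) r)) rs.
  apply/allP => x /rs_prim prim_x.
  by rewrite rootE -[_.[x]]/(ev x v r) r_ev // Q_v.
apply/eqP/negPn/negP => r_neq0; have := max_poly_roots r_neq0 all_rs uniq_rs.
rewrite size_rs ltnNge; apply/negP/negPn; apply: leq_trans size_r.
exact: size_poly.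
Qed.

(** * Linear equations over the ring generated by the values *)

(** The subring of K generated by the values of chi. Integer coefficients are
    needed because -1 is not a value of chi when F has characteristic 2. *)
Definition chi_ring (x : K) : Prop :=
  exists s : seq (int * F), x = \sum_(q <- s) q.1%:~R * chi q.2.

Lemma chi_ring0 : chi_ring 0.
Proof. by exists [::]; rewrite big_nil. Qed.

Lemma chi_ring_chi a : chi_ring (chi a).
Proof. by exists [:: (1, a)]; rewrite big_seq1 mul1r. Qed.

Lemma chi_ring1 : chi_ring 1.
Proof. by rewrite -chi1; apply: chi_ring_chi. Qed.

Lemma chi_ringD x y : chi_ring x -> chi_ring y -> chi_ring (x + y).
Proof. by move=> [s ->] [t ->]; exists (s ++ t); rewrite big_cat. Qed.

Lemma chi_ringN x : chi_ring x -> chi_ring (- x).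
Proof.
move=> [s ->]; exists [seq (- q.1, q.2) | q <- s].
by rewrite big_map -sumrN; apply: eq_bigr => q _; rewrite rmorphN mulNr.
Qed.

Lemma chi_ringM x y : chi_ring x -> chi_ring y -> chi_ring (x * y).
Proof.
move=> [s ->] [t ->]; exists [seq (q.1 * q'.1, q.2 * q'.2) | q <- s, q' <- t].
rewrite big_allpairs_dep mulr_suml; apply: eq_bigr => q _.
rewrite mulr_sumr; apply: eq_bigr => q' _ /=.
by rewrite rmorphM chiM mulrACA.
Qed.

Lemma chi_ring_int (c : int) : chi_ring c%:~R.
Proof. by exists [:: (c, 1)]; rewrite big_seq1 chi1 mulr1. Qed.

Lemma chi_ring_nat n : chi_ring n%:R.
Proof. exact: (chi_ring_int n). Qed.

Lemma chi_ring_sum (I : Type) (r : seq I) (P : pred I) (f : I -> K) :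
  (forall i, chi_ring (f i)) -> chi_ring (\sum_(i <- r | P i) f i).
Proof. by move=> f_R; apply: big_ind => //; [apply: chi_ring0 | apply: chi_ringD]. Qed.

Lemma chi_ring_prod (I : Type) (r : seq I) (P : pred I) (f : I -> K) :
  (forall i, chi_ring (f i)) -> chi_ring (\prod_(i <- r | P i) f i).
Proof. by move=> f_R; apply: big_ind => //; [apply: chi_ring1 | apply: chi_ringM]. Qed.

Lemma chi_ring_det n (A : 'M[K]_n) :
  (forall i j, chi_ring (A i j)) -> chi_ring (\det A).
Proof.
move=> A_R; apply: chi_ring_sum => s; apply: chi_ringM; last exact: chi_ring_prod.
by rewrite -(rmorph_sign intr); apply: chi_ring_int.
Qed.

Lemma chi_ring_mulmx m n q (A : 'M[K]_(m, n)) (B : 'M[K]_(n, q)) :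
  (forall i j, chi_ring (A i j)) -> (forall i j, chi_ring (B i j)) ->
  forall i j, chi_ring ((A *m B) i j).
Proof.
by move=> A_R B_R i j; rewrite mxE; apply: chi_ring_sum => k; apply: chi_ringM.
Qed.

(** The solutions r of r.g = 0 with entries in the subring are spanned over K by
    finitely many of them, the rows of B. Choosing columns f on which B has an
    invertible minor C, a vector r lies in the span of B exactly when
    det C * r = r_f * adj C * B, an equation over the subring. *)
Lemma chi_ring_equations m (g : 'I_m -> K) :
  exists2 N : 'M[K]_m, forall i j, chi_ring (N i j) &
    forall r : 'rV[K]_m, (forall i, chi_ring (r 0 i)) ->
      \sum_i r 0 i * g i = 0 <-> r *m N = 0.
Proof.
pose col_g := \col_i g i.
have sumE (r : 'rV[K]_m) : (\sum_i r 0 i * g i = 0) <-> (r *m col_g = 0).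
  split=> [sum0|/(congr1 (fun A : 'M_1 => A 0 0))].
    apply/matrixP => i j; rewrite !mxE (ord1 i) -[RHS]sum0.
    by apply: eq_bigr => k _; rewrite mxE.
  rewrite !mxE => eq0; rewrite -[RHS]eq0.
  by apply: eq_bigr => k _; rewrite mxE.
have [s [B [free_B B_S B_span]]] := basis_in_set
  (fun r => (forall i, chi_ring (r 0 i)) /\ r *m col_g = 0).
have B_R i j : chi_ring (B i j).
  by have [/(_ j)] := B_S i; rewrite mxE.
have Bg : B *m col_g = 0.
  by apply/row_matrixP => i; rewrite row_mul (B_S i).2 row0.
have full_B : row_full B^T by rewrite /row_full mxrank_tr.
pose f := fullrankfun full_B; pose C := colsub f B.
have C_unit : C \in unitmx.
  rewrite -unitmx_tr; have -> : C^T = rowsub f B^T by apply/matrixP => i j; rewrite !mxE.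
  exact: fullrowsub_unit.
have C_R i j : chi_ring (C i j) by rewrite mxE.
have adj_R i j : chi_ring (\adj C i j).
  rewrite mxE /cofactor; apply: chi_ringM.
    by rewrite -(rmorph_sign intr); apply: chi_ring_int.
  by apply: chi_ring_det => i' j'; rewrite !mxE.
pose E : 'M[K]_(m, s) := colsub f 1%:M.
have rE (r : 'rV[K]_m) : r *m E = colsub f r by rewrite mulmx_colsub mulmx1.
exists ((\det C)%:M - E *m \adj C *m B) => [i j|r r_R].
  rewrite mxE [X in _ + X]mxE; apply: chi_ringD; last first.
    apply/chi_ringN/chi_ring_mulmx => // i' j'; apply: chi_ring_mulmx => // {}i' {}j'.
    by rewrite !mxE; apply: chi_ring_nat.
  rewrite mxE -mulr_natr; apply: chi_ringM; first exact: chi_ring_det.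
  exact: chi_ring_nat.
rewrite sumE mulmxBr mul_mx_scalar !mulmxA rE; split=> [rg0|/eqP].
  have /submxP[x ->] : (r <= B)%MS by apply: B_span.
  rewrite -mulmx_colsub -/C -(mulmxA x C) mul_mx_adj mul_mx_scalar.
  by rewrite scalemxAl subrr.
rewrite subr_eq0 => /eqP rB; have det_neq0 : \det C != 0 by rewrite -unitfE -unitmxE.
apply: (scalerI det_neq0); rewrite scaler0 scalemxAl rB.
by rewrite -!mulmxA Bg !mulmx0.
Qed.

(** A large integer y0 works. Since C may be replaced by finitely many vectors
    with entries in the ring generated by chi, the equations become vanishing
    sums with coefficients c_i * y0^d_i, and [vanishing_sum_large_base]
    applies. *)
Lemma generic_value_exists n (C : 'I_n -> K) (d : 'I_n -> nat) :
  exists y0 : K, forall z : 'I_n -> F,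
    \sum_i C i * y0 ^+ d i * chi (z i) = 0 ->
    forall j, \sum_(i | d i == j) C i * chi (z i) = 0.
Proof.
have [N N_R N_eq] := chi_ring_equations C.
have {}N_eq (r : 'I_n -> K) : (forall i, chi_ring (r i)) ->
    \sum_i r i * C i = 0 <-> forall l, \sum_i r i * N i l = 0.
  move=> r_R; have rE i : (\row_i r i) 0 i = r i by rewrite mxE.
  have -> : \sum_i r i * C i = \sum_i (\row_i r i) 0 i * C i.
    by apply: eq_bigr => i _; rewrite rE.
  apply: iff_trans (N_eq _ _) _ => [i|]; first by rewrite rE.
  split=> [/matrixP rN l|rN].
    have := rN 0 l; rewrite mxE [RHS]mxE => eq0; rewrite -[RHS]eq0.
    by apply: eq_bigr => i _; rewrite rE.
  apply/matrixP => i l; rewrite (ord1 i) mxE [RHS]mxE -[RHS](rN l).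
  by apply: eq_bigr => i' _; rewrite rE.
have /fin_all_exists[s sE] (i : 'I_n) : exists s : 'I_n -> seq (int * F),
    forall l, N i l = \sum_(q <- s l) q.1%:~R * chi q.2.
  exact: fin_all_exists (N_R i).
pose TT l := {i : 'I_n & 'I_(size (s i l))}.
pose q l (x : TT l) := tnth (in_tuple (s (tag x) l)) (tagged x).
have NE l (P : pred 'I_n) (r : 'I_n -> K) : \sum_(i | P i) r i * N i l =
    \sum_(x : TT l | P (tag x)) r (tag x) * ((q l x).1%:~R * chi (q l x).2).
  transitivity (\sum_(i | P i) \sum_(j < size (s i l)) r i *
      ((tnth (in_tuple (s i l)) j).1%:~R * chi (tnth (in_tuple (s i l)) j).2)).
    by apply: eq_bigr => i _; rewrite sE big_tnth mulr_sumr.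
  by rewrite sig_big_dep /=; apply: eq_bigl => x; rewrite andbT.
have /fin_all_exists[B BP] l :=
  vanishing_sum_large_base (fun x : TT l => (q l x).1) (fun x => d (tag x)).
pose m := \max_l B l; exists m%:R => z sum0 j.
have zN : forall l, \sum_i m%:R ^+ d i * chi (z i) * N i l = 0.
  apply/N_eq => [i|].
    apply: chi_ringM; last exact: chi_ring_chi.
    by rewrite -natrX; apply: chi_ring_nat.
  rewrite -[RHS]sum0; apply: eq_bigr => i _.
  by rewrite mulrC mulrA.
have zjN : forall l, \sum_i (if d i == j then chi (z i) else 0) * N i l = 0.
  move=> l; transitivity (\sum_(i | d i == j) chi (z i) * N i l).
    rewrite [RHS]big_mkcond; apply: eq_bigr => i _.
    by case: eqP => // _; rewrite mul0r.
  rewrite NE -[RHS](BP l m _ (fun x : TT l => (q l x).2 * z (tag x)) _ j).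
  - by apply: eq_bigr => x _; rewrite chiM mulrC -mulrA.
  - exact: leq_bigmax.
  - rewrite -[RHS](zN l) NE; apply: eq_bigr => x _; rewrite rmorphM rmorphXn chiM /=.
    by rewrite -[_%:Z%:~R]/(m%:R) mulrACA mulrC.
transitivity (\sum_i (if d i == j then chi (z i) else 0) * C i).
  rewrite big_mkcond; apply: eq_bigr => i _.
  by case: eqP => // _; rewrite ?mul0r // mulrC.
apply/N_eq => // i; case: eqP => _; [exact: chi_ring_chi | exact: chi_ring0].
Qed.

(** * Equations in both sorts *)

(** The functions given by terms of the second sort. *)
Inductive kdef (I : Type) (k : nat) : ((I -> F) -> k.-tuple K -> K) -> Prop :=
| kdef_var j : kdef (fun _ y => tnth y j)
| kdef_chi f : @tdef F I f -> kdef (fun e _ => chi (f e))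
| kdef0 : kdef (fun _ _ => 0)
| kdef1 : kdef (fun _ _ => 1)
| kdefD f g : kdef f -> kdef g -> kdef (fun e y => f e y + g e y)
| kdefN f : kdef f -> kdef (fun e y => - f e y)
| kdefM f g : kdef f -> kdef g -> kdef (fun e y => f e y * g e y)
| kdef_ext f g : (forall e y, f e y = g e y) -> kdef f -> kdef g.

Section Kdef.

Variables (I : Type) (k : nat).
Implicit Types f g : (I -> F) -> k.-tuple K -> K.

Lemma kdef_sum (J : Type) (s : seq J) (P : pred J) (f : J -> _) :
  (forall j, kdef (f j)) -> @kdef I k (fun e y => \sum_(j <- s | P j) f j e y).
Proof.
move=> df; elim: s => [|j s IHs].
  by apply: kdef_ext (kdef0 I k) => e y; rewrite big_nil.
have [Pj|/negPf Pj] := boolP (P j).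
  by apply: kdef_ext (kdefD (df j) IHs) => e y; rewrite big_cons Pj.
by apply: kdef_ext IHs => e y; rewrite big_cons Pj.
Qed.

Lemma kdef_prod (J : Type) (s : seq J) (P : pred J) (f : J -> _) :
  (forall j, kdef (f j)) -> @kdef I k (fun e y => \prod_(j <- s | P j) f j e y).
Proof.
move=> df; elim: s => [|j s IHs].
  by apply: kdef_ext (kdef1 I k) => e y; rewrite big_nil.
have [Pj|/negPf Pj] := boolP (P j).
  by apply: kdef_ext (kdefM (df j) IHs) => e y; rewrite big_cons Pj.
by apply: kdef_ext IHs => e y; rewrite big_cons Pj.
Qed.

Lemma kdef_nat n : @kdef I k (fun _ _ => n%:R).
Proof.
elim: n => [|n IHn]; first exact: kdef0.
by apply: kdef_ext (kdefD (kdef1 I k) IHn) => e y; rewrite -natr1 addrC.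
Qed.

Lemma kdef_int (c : int) : @kdef I k (fun _ _ => c%:~R).
Proof.
case: c => n; first exact: kdef_nat.
by apply: kdef_ext (kdefN (kdef_nat n.+1)) => e y; rewrite NegzE rmorphN.
Qed.

Lemma kdefX f n : kdef f -> kdef (fun e y => f e y ^+ n).
Proof.
move=> df; apply: kdef_ext (kdef_prod (index_enum 'I_n) predT (fun=> df)) => e y.
by rewrite prodr_const card_ord.
Qed.

Lemma kdef_det n (A : 'I_n -> 'I_n -> (I -> F) -> k.-tuple K -> K) :
  (forall i j, kdef (A i j)) ->
  kdef (fun e y => \det (\matrix_(i, j) A i j e y)).
Proof.
move=> dA; pose f (s : 'S_n) e y := ((-1) ^+ s)%:~R * \prod_i A i (s i) e y.
apply: (@kdef_ext _ _ (fun e y => \sum_s f s e y)).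
  move=> e y; apply: eq_bigr => s _; rewrite /f rmorph_sign; congr (_ * _).
  by apply: eq_bigr => i _; rewrite mxE.
by apply: kdef_sum => s; apply: kdefM; [apply: kdef_int | apply: kdef_prod].
Qed.

(** A linear combination of the values of chi on z whose coefficients are fixed
    integral monomials in y. The integers c cannot be absorbed into z, since
    -1 need not be a value of chi. *)
Definition shape_sum (T : finType) (c : T -> int) (m : T -> 'I_k -> nat)
  (y : k.-tuple K) (z : T -> F) : K :=
  \sum_t (c t)%:~R * monomial_at (tnth y) (m t) * chi (z t).

(** As chi is multiplicative, every term of the second sort can be expanded into
    such a combination of values of chi on terms of the first sort. *)
Lemma kdef_shape f : kdef f ->
  exists (T : finType) (c : T -> int) (m : T -> 'I_k -> nat) (w : T -> (I -> F) -> F),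
    (forall t, tdef (w t)) /\ forall e y, f e y = shape_sum c m y (fun t => w t e).
Proof.
rewrite /shape_sum; elim=> {f} [j|f df|||f g _ [T [c [m [w [dw fE]]]]] _ [S [d [n [v [dv gE]]]]]
  |f _ [T [c [m [w [dw fE]]]]]|f g _ [T [c [m [w [dw fE]]]]] _ [S [d [n [v [dv gE]]]]]
  |f g fg _ [T [c [m [w [dw fE]]]]]].
- exists unit, (fun=> 1), (fun _ i => (i == j) : nat), (fun _ _ => 1).
  split=> [_|e y]; first exact: tdef1.
  rewrite (big_pred1 tt) => [|[]//]; rewrite chi1 mulr1 mul1r /monomial_at.
  rewrite (bigD1 j) //= eqxx expr1 big1 ?mulr1 // => i /negPf->.
  by rewrite expr0.
- exists unit, (fun=> 1), (fun _ _ => 0%N), (fun=> f); split=> // e y.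
  by rewrite (big_pred1 tt) => [|[]//]; rewrite monomial_at0 !mul1r.
- exists void, (fun=> 1), (fun _ _ => 0%N), (fun _ _ => 1); split=> [[]|e y].
  by rewrite big_pred0 // => -[].
- exists unit, (fun=> 1), (fun _ _ => 0%N), (fun _ _ => 1).
  split=> [_|e y]; first exact: tdef1.
  by rewrite (big_pred1 tt) => [|[]//]; rewrite monomial_at0 chi1 !mul1r.
- exists (T + S)%type, (sumf c d), (sumf m n), (sumf w v); split=> [[]//|e y].
  by rewrite big_sumType /= fE gE.
- exists T, (fun t => - c t), m, w; split=> // e y; rewrite fE -sumrN.
  by apply: eq_bigr => t _; rewrite rmorphN !mulNr.
- exists (T * S)%type, (fun x => c x.1 * d x.2), (fun x i => m x.1 i + n x.2 i)%N.
  exists (fun x e => w x.1 e * v x.2 e); split=> [[t s]|e y]; first exact: tdefM.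
  rewrite fE gE mulr_suml -(pair_bigA _ (fun t s => (c t * d s)%:~R
    * monomial_at (tnth y) (fun i => m t i + n s i)%N * chi (w t e * v s e))) /=.
  apply: eq_bigr => t _; rewrite mulr_sumr; apply: eq_bigr => s _.
  by rewrite rmorphM monomial_atD chiM mulrACA [_%:~R * _ * (_%:~R * _)]mulrACA.
- by exists T, c, m, w; split=> // e y; rewrite -fg fE.
Qed.

End Kdef.

(** Boolean combinations of equations of the second sort. *)
Inductive qf (I : Type) (k : nat) : ((I -> F) -> k.-tuple K -> Prop) -> Prop :=
| qf_eq f : kdef f -> qf (fun e y => f e y = 0)
| qf_not A : qf A -> qf (fun e y => ~ A e y)
| qf_and A B : qf A -> qf B -> qf (fun e y => A e y /\ B e y)
| qf_ext A B : (forall e y, A e y <-> B e y) -> qf A -> qf B.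

Lemma qf_forall_fin (I : Type) (k : nat) (T : finType)
    (A : T -> (I -> F) -> k.-tuple K -> Prop) :
  (forall t, qf (A t)) -> qf (fun e y => forall t, A t e y).
Proof.
move=> dA; have dAs (s : seq T) : qf (fun e y => forall t, t \in s -> A t e y).
  elim: s => [|t s IHs].
    by apply: qf_ext (qf_eq (kdef0 I k)) => e y; split.
  apply: qf_ext (qf_and (dA t) IHs) => e y; split=> [[At As] t'|As].
    by rewrite inE => /predU1P[->|/As].
  by split=> [|t' t's]; apply: As; rewrite inE ?eqxx ?t's ?orbT.
by apply: qf_ext (dAs (enum T)) => e y; split=> As t; [|move=> _]; apply: As; rewrite ?mem_enum.
Qed.

Lemma qf_exists_fin (I : Type) (k : nat) (T : finType)
    (A : T -> (I -> F) -> k.-tuple K -> Prop) :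
  (forall t, qf (A t)) -> qf (fun e y => exists t, A t e y).
Proof.
move=> dA; apply: (@qf_ext _ _ (fun e y => ~ forall t, ~ A t e y)).
  by move=> e y; split=> [/not_all_not_ex|[t At] nA] //; case: (nA t).
by apply/qf_not/qf_forall_fin => t; apply: qf_not.
Qed.

Lemma qf_nz_minor I k m n r (A : 'I_m -> 'I_n -> (I -> F) -> k.-tuple K -> K) :
  (forall i j, kdef (A i j)) ->
  qf (fun e y => nz_minor (\matrix_(i, j) A i j e y) r).
Proof.
move=> dA; apply: qf_exists_fin => f; apply: qf_exists_fin => g; apply: qf_not.
apply: qf_eq; apply: kdef_ext (kdef_det (fun i j => dA (f i) (g j))) => e y.
by congr (\det _); apply/matrixP => i j; rewrite !mxE.
Qed.

Lemma qf_in_span I k (S T : finType) (v : T -> (I -> F) -> k.-tuple K -> K)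
    (A : S -> T -> (I -> F) -> k.-tuple K -> K) :
  (forall t, kdef (v t)) -> (forall s t, kdef (A s t)) ->
  qf (fun e y => exists a : S -> K, forall t, v t e y = \sum_s a s * A s t e y).
Proof.
move=> dv dA; pose m := #|S|; pose n := #|T|.
pose MA e y : 'M[K]_(m, n) := \matrix_(i, j) A (enum_val i) (enum_val j) e y.
pose W (i : 'I_(m + 1)) (j : 'I_n) e y := match split i with
  | inl i => A (enum_val i) (enum_val j) e y | inr _ => v (enum_val j) e y end.
pose MW e y : 'M[K]_(m + 1, n) := \matrix_(i, j) W i j e y.
have dW i j : kdef (W i j).
  by rewrite /W; case: (split i) => i'; [apply: dA | apply: dv].
(* The vector v is in the span of the A s when appending it does not increase
   the rank; the rank of MW is at most m + 1. *)
apply: (@qf_ext _ _ (fun e y => exists r : 'I_(m + 2), nz_minor (MA e y) r /\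
    forall r' : 'I_(m + 2), ~ ((r < r')%N /\ nz_minor (MW e y) r'))); last first.
  apply: qf_exists_fin => r; apply: qf_and; first exact: qf_nz_minor.
  apply: qf_forall_fin => r'; apply/qf_not/qf_and; last exact: qf_nz_minor.
  have [lt|nlt] := boolP (r < r')%N.
    by apply: qf_ext (qf_eq (kdef0 I k)) => e y; split.
  by apply: qf_ext (qf_not (qf_eq (kdef0 I k))) => e y; split.
move=> e y; pose V : 'rV[K]_n := \row_j v (enum_val j) e y.
have MWE : MW e y = col_mx (MA e y) V.
  apply/matrixP => i j; rewrite !mxE /W; case: (split i) => i'; by rewrite !mxE.
have rankMW : (\rank (MW e y) < m + 2)%N.
  by rewrite addn2 ltnS; apply: leq_trans (rank_leq_row _) _; rewrite addn1.
have MA_le : (MA e y <= MW e y)%MS by rewrite MWE -addsmxE addsmxSl.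
apply: (@iff_trans _ (V <= MA e y)%MS).
  split=> [[r [r_MA r_max]]|V_MA].
    have rank_le : (\rank (MW e y) <= \rank (MA e y))%N.
      apply: leq_trans (nz_minor_le_rank r_MA); rewrite leqNgt; apply/negP => lt.
      by apply: (r_max (Ordinal rankMW)); split=> //; apply: nz_minor_rank.
    apply: submx_trans (_ : (MW e y <= MA e y)%MS).
      by rewrite MWE -addsmxE addsmxSr.
    by rewrite -(mxrank_leqif_sup MA_le) eqn_leq rank_le mxrankS.
  have rankE : \rank (MW e y) = \rank (MA e y).
    apply/eqP; rewrite eqn_leq [X in _ && X]mxrankS // andbT mxrankS //.
    by rewrite MWE -addsmxE addsmx_sub submx_refl.
  have lt_r : (\rank (MA e y) < m + 2)%N by rewrite -rankE.
  exists (Ordinal lt_r); split; first exact: nz_minor_rank.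
  by move=> r' [/= lt /nz_minor_le_rank]; rewrite rankE leqNgt lt.
split=> [/submxP[x Vx]|[a aE]].
  exists (fun s => x 0 (enum_rank s)) => t.
  have := congr1 (fun M : 'rV_n => M 0 (enum_rank t)) Vx; rewrite !mxE enum_rankK => ->.
  rewrite (reindex (@enum_rank S)) /=; last first.
    by apply: onW_bij; apply: enum_rank_bij.
  by apply: eq_bigr => s _; rewrite mxE !enum_rankK.
apply/submxP; exists (\row_i a (enum_val i)); apply/matrixP => i j.
rewrite !mxE aE (reindex (fun i : 'I_#|S| => enum_val i)) /=; last first.
  by apply: onW_bij; apply: enum_val_bij.
by apply: eq_bigr => s _; rewrite !mxE.
Qed.

(** * Reduction of two-sorted formulas to the first sort *)

Lemma fdef_prim_root (I : Type) e (f : (I -> F) -> F) : tdef f ->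
  fdef (fun x => e.-primitive_root (f x)).
Proof.
move=> df; apply: (@fdef_ext _ _ (fun x => (0 < e)%N /\
    forall i : 'I_e, f x ^+ i.+1 = 1 <-> i.+1 = e)).
  move=> x; split=> [[e_gt0 fx]|/andP[e_gt0 /forallP fx]].
    apply/andP; split=> //; apply/forallP => i; rewrite unity_rootE; apply/eqP.
    by apply/eqP/eqP; apply fx.
  split=> // i; have := fx i; rewrite unity_rootE => /eqP fxi.
  by split=> /eqP; [rewrite fxi | rewrite -fxi]; move/eqP.
apply: fdef_and; first exact: fdef_const.
apply: fdef_forall_fin => i; apply: fdef_iff; last exact: fdef_const.
by apply: fdef_eq; [apply: tdefX | apply: tdef1].
Qed.

(** The root of unity in [vanishing_sum_linear] can be quantified away, as the
    set of admissible patterns is the same for all primitive roots. *)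
Lemma fdef_vanishing_sum (T : finType) (c : T -> int) :
  fdef (fun u : T -> F => \sum_i (c i)%:~R * chi (u i) = 0).
Proof.
have [e [good [[w0 prim_w0] goodP]]] := vanishing_sum_linear c.
apply: (@fdef_ext _ _ (fun u => exists w, e.-primitive_root w /\
    exists t : {ffun T -> option (T * 'I_e)}, t \in good /\
      forall i, u i = lin_value w u (t i))).
  move=> u; split=> [[w [prim_w [t [t_good u_t]]]]|].
    by apply/(goodP w prim_w); exists t.
  by move=> /(goodP w0 prim_w0)[t t_good u_t]; exists w0; split=> //; exists t.
pose A (v : option T -> F) := e.-primitive_root (v None) /\
  exists t : {ffun T -> option (T * 'I_e)}, t \in good /\
    forall i, v (Some i) = lin_value (v None) (v \o Some) (t i).
apply: (@fdef_ex _ _ A); apply: fdef_and.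
  by apply: fdef_prim_root; apply: tdef_var.
apply: fdef_exists_fin => t; apply: fdef_and; first exact: fdef_const.
apply: fdef_forall_fin => i; apply: fdef_eq; first exact: tdef_var.
rewrite /lin_value; case: (t i) => [[b k]|]; last exact: tdef0.
by apply: tdefM; [apply: tdef_var | apply: tdefX; apply: tdef_var].
Qed.

Lemma fdef_qf0 (I : Type) (A : (I -> F) -> 0.-tuple K -> Prop) :
  qf A -> fdef (fun e => A e [tuple]).
Proof.
elim=> {A} [f /kdef_shape[T [c [m [w [dw fE]]]]]|A _ IHA|A B _ IHA _ IHB|A B AB _ IHA].
- apply: fdef_ext (fdef_subst (fdef_vanishing_sum c) dw) => e.
  rewrite fE /shape_sum; suffices -> : \sum_i (c i)%:~R * chi (w i e) =
    \sum_t (c t)%:~R * monomial_at (tnth [tuple]) (m t) * chi (w t e) by [].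
  by apply: eq_bigr => t _; rewrite /monomial_at big_ord0 mulr1.
- exact: fdef_not.
- exact: fdef_and.
- by apply: fdef_ext IHA => e; apply: AB.
Qed.

Definition span_of (T : finType) (g : T * T -> F) (z : T -> F) : Prop :=
  exists a : T -> K, forall t, chi (z t) = \sum_s a s * chi (g (s, t)).

Lemma fdef_span_of (I : Type) (T : finType) (g : T * T -> (I -> F) -> F)
    (z : T -> (I -> F) -> F) :
  (forall x, tdef (g x)) -> (forall t, tdef (z t)) ->
  fdef (fun e => span_of (fun x => g x e) (fun t => z t e)).
Proof.
move=> dg dz; pose v t (e : I -> F) (_ : 0.-tuple K) := chi (z t e).
pose A s t (e : I -> F) (_ : 0.-tuple K) := chi (g (s, t) e).
have dv t : kdef (v t) by apply: kdef_chi.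
have dA s t : kdef (A s t) by apply: kdef_chi.
exact: fdef_qf0 (qf_in_span dv dA).
Qed.

Section Codes.

Variables (T : finType) (k : nat) (c : T -> int) (m : T -> 'I_k -> nat).

(** The points g s of F^T solve the equation with coefficients given by y, and
    their images under chi span the images of all solutions. As many points as
    coordinates suffice, so the size of a code does not depend on y. *)
Definition code (y : k.-tuple K) (g : T * T -> F) : Prop :=
  (forall s, shape_sum c m y (fun t => g (s, t)) = 0) /\
  forall z, shape_sum c m y z = 0 -> span_of g z.

(** A code determines the set of solutions, by a condition in which y no longer
    occurs. *)
Lemma code_span y g z : code y g -> shape_sum c m y z = 0 <-> span_of g z.
Proof.
move=> [g0 g_span]; split=> [|[a aE]]; first exact: g_span.
rewrite /shape_sum; under eq_bigr do rewrite aE mulr_sumr.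
rewrite exchange_big big1 //= => s _; under eq_bigr do rewrite mulrCA.
by rewrite -mulr_sumr [X in _ * X](g0 s) mulr0.
Qed.

Lemma code_exists y : exists g, code y g.
Proof.
pose S (r : 'rV[K]_#|T|) := exists2 z, shape_sum c m y z = 0 &
  forall i, r 0 i = chi (z (enum_val i)).
have S0 : S 0.
  exists (fun=> 0) => [|i]; last by rewrite mxE chi0.
  by rewrite /shape_sum big1 // => t _; rewrite chi0 mulr0.
have [B [B_S B_span]] : exists B : 'M[K]_#|T|, (forall i, S (row i B)) /\
    forall r, S r -> (r <= B)%MS.
  move: #|T| S S0 => n S S0; have [s [B [free_B B_S B_span]]] := basis_in_set S.
  have [d n_eq] : exists d, n = (s + d)%N.
    by exists (n - s)%N; rewrite subnKC // -(eqP free_B) rank_leq_col.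
  subst n; exists (col_mx B 0); split=> [i|r /B_span r_B].
    have [j ->|j ->] := split_ordP i; first by rewrite rowKu.
    by rewrite rowKd row0.
  by rewrite -addsmxE; apply: submx_trans r_B (addsmxSl _ _).
have /fin_all_exists[z zP] (i : 'I_#|T|) : exists z : T -> F,
    shape_sum c m y z = 0 /\ forall j, B i j = chi (z (enum_val j)).
  have [z z0 zE] := B_S i; exists z; split=> // j.
  by rewrite -zE mxE.
exists (fun x => z (enum_rank x.1) x.2); split=> [s|v v0].
  by case: (zP (enum_rank s)).
have /submxP[x xE] : (\row_i chi (v (enum_val i)) <= B)%MS.
  by apply: B_span; exists v => // i; rewrite mxE.
exists (fun s => x 0 (enum_rank s)) => t.
have := congr1 (fun M : 'rV_#|T| => M 0 (enum_rank t)) xE.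
rewrite !mxE enum_rankK => ->; rewrite (reindex (@enum_rank T)) /=; last first.
  by apply: onW_bij; apply: enum_rank_bij.
by apply: eq_bigr => s _; rewrite (zP _).2 enum_rankK.
Qed.

End Codes.

(** The truth of A at (e, y) is a first-order property, in the field F, of e and
    of an arbitrary code of y for suitable monomials. *)
Definition nf (I : Type) (k : nat) (A : (I -> F) -> k.-tuple K -> Prop) : Prop :=
  exists (T : finType) (c : T -> int) (m : T -> 'I_k -> nat) B,
    @fdef F (I + T * T) B /\
    forall e y g, code c m y g -> A e y <-> B (sumf e g).

Section Nf.

Variables (k : nat).

Lemma nf_ext I (A B : (I -> F) -> k.-tuple K -> Prop) :
  (forall e y, A e y <-> B e y) -> nf A -> nf B.
Proof.
move=> AB [T [c [m [C [dC CE]]]]]; exists T, c, m, C; split=> // e y g g_code.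
by rewrite -AB (CE e y g g_code).
Qed.

Lemma nf_not I (A : (I -> F) -> k.-tuple K -> Prop) :
  nf A -> nf (fun e y => ~ A e y).
Proof.
move=> [T [c [m [C [dC CE]]]]]; exists T, c, m, (fun x => ~ C x).
by split=> [|e y g g_code]; [apply: fdef_not | rewrite (CE e y g g_code)].
Qed.

Definition pad (T T' : Type) (h : T' -> option T) (z : T -> F) (t' : T') : F :=
  oapp z 0 (h t').

(** If every equation of the shape (c, m) is one of the shape (c', m'), up to
    inserting zero coordinates, then a code g' for the latter defines the set of
    codes g for the former. *)
Lemma nf_weaken I (A : (I -> F) -> k.-tuple K -> Prop)
    (T T' : finType) (c : T -> int) (m : T -> 'I_k -> nat)
    (c' : T' -> int) (m' : T' -> 'I_k -> nat) (h : T' -> option T) B :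
  (forall y z, shape_sum c' m' y (pad h z) = shape_sum c m y z) ->
  @fdef F (I + T * T) B ->
  (forall e y g, code c m y g -> A e y <-> B (sumf e g)) ->
  exists2 B', @fdef F (I + T' * T') B' &
    forall e y g, code c' m' y g -> A e y <-> B' (sumf e g).
Proof.
move=> padE dB BE.
pose C (x : (I + T' * T') + (T * T) -> F) :=
  (forall s, span_of (fun p => x (inl (inr p))) (pad h (fun t => x (inr (s, t))))) /\
  (forall z, span_of (fun p => x (inl (inr p))) (pad h z) ->
     span_of (fun p => x (inr p)) z) /\
  B (sumf (fun i => x (inl (inl i))) (fun p => x (inr p))).
have d_pad J (z : T -> (J -> F) -> F) t' : (forall t, tdef (z t)) ->
    tdef (fun e => pad h (fun t => z t e) t').
  by move=> dz; rewrite /pad; case: (h t') => [t|] //=; apply: tdef0.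
have dC : fdef C.
  apply: fdef_and; last apply: fdef_and.
  - apply: fdef_forall_fin => s; apply: fdef_span_of => [q|t']; first exact: tdef_var.
    by apply: d_pad => t; apply: tdef_var.
  - pose C' (x : ((I + T' * T') + (T * T)) + T -> F) :=
      span_of (fun p => x (inl (inl (inr p)))) (pad h (fun t => x (inr t))) ->
      span_of (fun p => x (inl (inr p))) (fun t => x (inr t)).
    apply: (@fdef_ext _ _ (fun x => forall z, C' (sumf x z))) => //.
    apply: fdef_forall_fun; apply: fdef_imp.
      apply: fdef_span_of => [q|t']; first exact: tdef_var.
      by apply: d_pad => t; apply: tdef_var.
    by apply: fdef_span_of => [q|t]; apply: tdef_var.
  - apply: (fdef_subst (s := fun (i : I + T * T) (x : (I + T' * T') + (T * T) -> F) =>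
      sumf (fun i => x (inl (inl i))) (fun p => x (inr p)) i) dB).
    by case=> [i|q]; apply: tdef_var.
exists (fun x => exists g, C (sumf x g)); first exact: fdef_exists_fun.
move=> e y g' g'_code; have spanE z := code_span (pad h z) g'_code.
split=> [Aey|[g [g_in [g_span Bg]]]].
  have [g g_code] := code_exists c m y; exists g; split=> [s|]; last split=> [z|].
  - by apply/spanE; rewrite padE; apply: g_code.1.
  - move=> /spanE; rewrite padE => z0; exact: (code_span z g_code).1 z0.
  - exact: (BE e y g g_code).1 Aey.
have g_code : code c m y g.
  split=> [s|z z0]; first by rewrite -padE; apply/spanE/(g_in s).
  by apply: g_span; apply/spanE; rewrite padE.
exact: (BE e y g g_code).2 Bg.
Qed.

Lemma nf_and I (A B : (I -> F) -> k.-tuple K -> Prop) :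
  nf A -> nf B -> nf (fun e y => A e y /\ B e y).
Proof.
move=> [T [c [m [C [dC CE]]]]] [S [d [n [D [dD DE]]]]].
have [|C' dC' C'E] := nf_weaken (c' := sumf c d) (m' := sumf m n)
  (h := fun x : T + S => match x with inl t => Some t | inr _ => None end) _ dC CE.
  move=> y z; rewrite /shape_sum big_sumType /= [X in _ + X]big1 ?addr0 // => s _.
  by rewrite chi0 mulr0.
have [|D' dD' D'E] := nf_weaken (c' := sumf c d) (m' := sumf m n)
  (h := fun x : T + S => match x with inl _ => None | inr s => Some s end) _ dD DE.
  move=> y z; rewrite /shape_sum big_sumType /= [X in X + _]big1 ?add0r // => s _.
  by rewrite chi0 mulr0.
exists (T + S)%type, (sumf c d), (sumf m n), (fun x => C' x /\ D' x).
split=> [|e y g g_code]; first exact: fdef_and.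
by rewrite (C'E _ _ _ g_code) (D'E _ _ _ g_code).
Qed.

Lemma nf_or I (A B : (I -> F) -> k.-tuple K -> Prop) :
  nf A -> nf B -> nf (fun e y => A e y \/ B e y).
Proof.
move=> nA nB; apply: nf_ext (nf_not (nf_and (nf_not nA) (nf_not nB))) => e y.
by have := classic (A e y); tauto.
Qed.

Lemma nf_fdef I (A : (I -> F) -> Prop) :
  fdef A -> nf (fun e (_ : k.-tuple K) => A e).
Proof.
move=> dA; exists void, (fun=> 0), (fun _ _ => 0%N), (fun x => A (fun i => x (inl i))).
by split=> //; apply: (fdef_reindex (fun i : I => inl i : I + void * void)).
Qed.

Lemma nf_exists_fin I (J : finType) (A : J -> (I -> F) -> k.-tuple K -> Prop) :
  (forall j, nf (A j)) -> nf (fun e y => exists j, A j e y).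
Proof.
move=> nA; have nAs (s : seq J) : nf (fun e y => exists2 j, j \in s & A j e y).
  elim: s => [|j s IHs].
    by apply: nf_ext (nf_fdef (fdef_const F I False)) => e y; split=> // -[].
  apply: nf_ext (nf_or (nA j) IHs) => e y; split=> [[Aj|[j' j's Aj']]|[j']].
  - by exists j; rewrite // inE eqxx.
  - by exists j'; rewrite // inE j's orbT.
  by rewrite inE => /predU1P[->|j's Aj']; [left | right; exists j'].
apply: nf_ext (nAs (enum J)) => e y; split=> [[j _ Aj]|[j Aj]]; exists j => //.
by rewrite mem_enum.
Qed.

Lemma nf_qf I (A : (I -> F) -> k.-tuple K -> Prop) : qf A -> nf A.
Proof.
elim=> {A} [f /kdef_shape[T [c [m [w [dw fE]]]]]|A _ IHA|A B _ IHA _ IHB|A B AB _ IHA].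
- exists T, c, m, (fun x => span_of (fun p => x (inr p)) (fun t => w t (fun i => x (inl i)))).
  split=> [|e y g g_code]; last by rewrite fE; apply: code_span.
  apply: fdef_span_of => [q|t]; first exact: tdef_var.
  by apply: (tdef_subst (dw t)) => i; apply: tdef_var.
- exact: nf_not.
- exact: nf_and.
- exact: nf_ext IHA.
Qed.

Lemma nf_reindex I J (A : (I -> F) -> k.-tuple K -> Prop) (s : I -> J) :
  nf A -> nf (fun e y => A (fun i => e (s i)) y).
Proof.
move=> [T [c [m [C [dC CE]]]]]; exists T, c, m.
pose s' (x : I + T * T) : J + T * T := match x with inl i => inl (s i) | inr p => inr p end.
exists (fun x => C (fun i => x (s' i))); split=> [|e y g g_code].
  exact: (fdef_reindex s').
rewrite (CE _ _ _ g_code).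
suffices -> : (fun i => sumf e g (s' i)) = sumf (fun i => e (s i)) g by [].
by apply: functional_extensionality => -[].
Qed.

(** Quantification over the first sort does not affect y, hence leaves the codes
    alone. *)
Lemma nf_exists_fun I (J : finType) (A : (I + J -> F) -> k.-tuple K -> Prop) :
  nf A -> nf (fun e y => exists g, A (sumf e g) y).
Proof.
move=> [T [c [m [C [dC CE]]]]]; exists T, c, m.
pose s (x : (I + J) + T * T) : (I + T * T) + J :=
  match x with inl (inl i) => inl (inl i) | inl (inr j) => inr j | inr p => inl (inr p) end.
exists (fun x => exists g, C (fun i => sumf x g (s i))); split=> [|e y g g_code].
  exact: (fdef_exists_fun (fdef_reindex s dC)).
have E v : (fun i => sumf (sumf e g) v (s i)) = sumf (sumf e v) g.
  by apply: functional_extensionality => -[[]|].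
split=> [[v Av]|[v Cv]]; exists v; first by rewrite E; apply: (CE _ _ g g_code).1 Av.
by apply/(CE _ _ g g_code); rewrite -E.
Qed.

End Nf.

Definition kpoly (I : Type) (k : nat) (P : (I -> F) -> k.-tuple K -> {poly K}) : Prop :=
  forall j, kdef (fun e y => (P e y)`_j).

Lemma kpolyM (I : Type) (k : nat) (P Q : (I -> F) -> k.-tuple K -> {poly K}) :
  kpoly P -> kpoly Q -> kpoly (fun e y => P e y * Q e y).
Proof.
move=> dP dQ j.
apply: (@kdef_ext _ _ (fun e y => \sum_(i < j.+1) (P e y)`_i * (Q e y)`_(j - i))).
  by move=> e y; rewrite coefM.
by apply: kdef_sum => i; apply: kdefM.
Qed.

Lemma kpolyXnM (I : Type) (k n : nat) (P : (I -> F) -> k.-tuple K -> {poly K}) :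
  kpoly P -> kpoly (fun e y => 'X^n * P e y).
Proof.
move=> dP j; have [lt|le] := ltnP j n.
  by apply: kdef_ext (kdef0 I k) => e y; rewrite coefXnM lt.
by apply: kdef_ext (dP (j - n)%N) => e y; rewrite coefXnM ltnNge le.
Qed.

Lemma kpoly_prod (I : Type) (k n : nat) (P : 'I_n -> (I -> F) -> k.-tuple K -> {poly K}) :
  (forall i, kpoly (P i)) -> kpoly (fun e y => \prod_i P i e y).
Proof.
elim: n P => [|n IHn] P dP j.
  by apply: kdef_ext (kdef_nat I k (j == 0%N)) => e y; rewrite big_ord0 coef1.
apply: kdef_ext (kpolyM (dP ord0) (IHn _ (fun i => dP (lift ord0 i))) j) => e y.
by rewrite big_ord_recl.
Qed.

Section ExistsK.

Variables (k : nat) (T : finType) (c : T -> int) (m : T -> 'I_k.+1 -> nat).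

(** The left-hand side of an equation for (y0, y), as a polynomial in the
    variable y0, which has index 0. *)
Definition qpoly (y : k.-tuple K) (z : T -> F) : {poly K} :=
  \sum_t ((c t)%:~R * monomial_at (tnth y) (fun i => m t (lift ord0 i)) * chi (z t))
    *: 'X^(m t ord0).

Lemma qpoly_val y z y0 : (qpoly y z).[y0] = shape_sum c m [tuple of y0 :: y] z.
Proof.
rewrite horner_sum; apply: eq_bigr => t _; rewrite hornerZ hornerXn.
rewrite mulrAC -!mulrA; congr (_ * _); rewrite mulrA; congr (_ * _).
rewrite /monomial_at [RHS]big_ord_recl mulrC; congr (_ * _).
by apply: eq_bigr => i _; rewrite !(tnth_nth 0).
Qed.

Let D := (\max_t m t ord0).+1.

Lemma size_qpoly y z : (size (qpoly y z) <= D)%N.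
Proof.
apply: leq_trans (size_sum _ _ _) _; apply/bigmax_leqP => t _.
apply: leq_trans (size_scale_leq _ _) _; rewrite size_polyXn ltnS.
exact: (leq_bigmax (F := fun t => m t ord0)).
Qed.

Lemma kpoly_qpoly (I : Type) (z : T -> (I -> F) -> F) : (forall t, tdef (z t)) ->
  kpoly (fun e y => qpoly y (fun t => z t e)).
Proof.
move=> dz j; pose f t e (y : k.-tuple K) := (c t)%:~R *
  monomial_at (tnth y) (fun i => m t (lift ord0 i)) * chi (z t e) * (j == m t ord0)%:R.
apply: (@kdef_ext _ _ (fun e y => \sum_t f t e y)).
  by move=> e y; rewrite coef_sum; apply: eq_bigr => t _; rewrite coefZ coefXn.
apply: kdef_sum => t; apply: kdefM; last exact: kdef_nat.
apply: kdefM; last exact: kdef_chi.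
apply: kdefM; first exact: kdef_int.
by apply: kdef_prod => i; apply: kdefX; apply: kdef_var.
Qed.

Lemma code_cons (y0 : K) (y : k.-tuple K) g : code c m [tuple of y0 :: y] g <->
  (forall s, (qpoly y (fun t => g (s, t))).[y0] = 0) /\
  forall z, (qpoly y z).[y0] = 0 -> span_of g z.
Proof.
split=> [[g0 g_span]|[g0 g_span]]; split=> [s|z].
- by rewrite qpoly_val.
- by rewrite qpoly_val; apply: g_span.
- by have := g0 s; rewrite qpoly_val.
- by move=> z0; apply: g_span; rewrite qpoly_val.
Qed.

(** Even if K is algebraic over the values of chi and y, some y0 satisfies no
    nontrivial equation of the given complexity. *)
Lemma qpoly_generic_value y : exists y0 : K, forall z, (qpoly y z).[y0] = 0 -> qpoly y z = 0.
Proof.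
pose C (i : 'I_#|T|) := (c (enum_val i))%:~R *
  monomial_at (tnth y) (fun j => m (enum_val i) (lift ord0 j)) : K.
have [y0 y0P] := @generic_value_exists #|T| C (fun i => m (enum_val i) ord0).
exists y0 => z qz0; apply/polyP => j; rewrite coef0 coef_sum.
have sumE (f : T -> K) : \sum_t f t = \sum_(i < #|T|) f (enum_val i).
  by rewrite (reindex (fun i : 'I_#|T| => enum_val i)) //; apply/onW_bij/enum_val_bij.
rewrite -[RHS](y0P (fun i => z (enum_val i)) _ j).
  rewrite sumE [RHS]big_mkcond; apply: eq_bigr => i _; rewrite coefZ coefXn eq_sym.
  by case: eqP => _; rewrite ?mulr1 ?mulr0.
rewrite -[RHS]qz0 horner_sum sumE; apply: eq_bigr => i _.
by rewrite hornerZ hornerXn mulrAC.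
Qed.

(** A witness that no common root of the equations imposed by g avoids all the
    equations that g forbids: every common root is a root of one of the l
    forbidden polynomials. *)
Definition bad_factors (y : k.-tuple K) (g : T * T -> F) (l : nat) : Prop :=
  exists z : 'I_l * T -> F, (forall i, ~ span_of g (fun t => z (i, t))) /\
    in_ideal (fun s => qpoly y (fun t => g (s, t)))
      (\prod_i qpoly y (fun t => z (i, t))).

(** If some imposed polynomial is nonzero, let h generate the ideal of all
    imposed polynomials. When no y0 works, each root of h, counted with
    multiplicity, is a root of a forbidden polynomial, so h divides their
    product. The degree of h, and with it the number of factors, is less than
    D. *)
Lemma exists_code_iff (y : k.-tuple K) g :
  (exists y0, code c m [tuple of y0 :: y] g) <->
  ((forall s, qpoly y (fun t => g (s, t)) = 0) /\
     forall z, qpoly y z = 0 -> span_of g z) \/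
  (~ (forall s, qpoly y (fun t => g (s, t)) = 0) /\
     ~ exists l : 'I_D, bad_factors y g l).
Proof.
pose P s := qpoly y (fun t => g (s, t)).
split=> [[y0 /code_cons[g0 g_span]]|[[P0 g_span]|[P_neq0 no_bad]]].
- have [P0|P_neq0] := classic (forall s, P s = 0); [left|right]; split=> //.
    by move=> z z0; apply: g_span; rewrite z0 horner0.
  move=> [l [z [z_bad [u /(congr1 (horner^~ y0))]]]].
  rewrite /= horner_sum [X in _ = X]big1 => [|s _]; last by rewrite hornerM g0 mulr0.
  move/eqP; rewrite horner_prod => /prodf_eq0[i _ /eqP zi0].
  exact: (z_bad i) (g_span _ zi0).
- have [y0 y0P] := qpoly_generic_value y; exists y0; apply/code_cons.
  by split=> [s|z /y0P/g_span //]; rewrite P0 horner0.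
apply: NNPP => no_y0; apply: no_bad.
have [h [u hE] h_dvd] := ideal_generator P.
have h_neq0 : h != 0.
  apply: contra_notN P_neq0 => /eqP h0 s.
  by have := h_dvd s; rewrite h0 dvd0p => /eqP.
have [s0 Ps0] : exists s, P s <> 0 by apply: not_all_ex_not.
have size_h : (size h <= D)%N.
  by apply: leq_trans (size_qpoly y _); apply: (dvdp_leq _ (h_dvd s0)); apply/eqP.
have [rs h_rs] := closed_field_poly_normal h.
have size_rs : (size rs < D)%N.
  by apply: leq_trans size_h; rewrite h_rs size_scale ?lead_coef_eq0 // size_prod_XsubC.
have bad_at (i : 'I_(size rs)) : exists z, (qpoly y z).[tnth (in_tuple rs) i] = 0 /\ ~ span_of g z.
  set r := tnth _ _; have hr0 : root h r.
    by rewrite h_rs rootZ ?lead_coef_eq0 // root_prod_XsubC mem_tnth.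
  apply: NNPP => no_z; apply: no_y0; exists r; apply/code_cons; split=> [s|z z0].
    by have /dvdpP[q] := h_dvd s; rewrite -/(P s) => ->; rewrite hornerM (eqP hr0) mulr0.
  by apply: NNPP => z_span; apply: no_z; exists z.
have /fin_all_exists[z zP] := bad_at.
exists (Ordinal size_rs), (fun x => z x.1 x.2); split=> [i|].
  by case: (zP i).
have [q qE] : exists q, \prod_i qpoly y (z i) = q * \prod_(r <- rs) ('X - r%:P).
  rewrite [\prod_(r <- rs) _]big_tnth.
  have /fin_all_exists[q qE] (i : 'I_(size rs)) : exists q,
      qpoly y (z i) = q * ('X - (tnth (in_tuple rs) i)%:P).
    by have [/eqP z0 _] := zP i; have /factor_theorem := z0.
  exists (\prod_i q i).
  by rewrite (eq_bigr _ (fun i _ => qE i)); apply: big_split.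
exists (fun s => (lead_coef h)^-1 *: q * u s).
transitivity (\sum_s ((lead_coef h)^-1 *: q) * (u s * P s)); last first.
  by apply: eq_bigr => s _; rewrite mulrA.
rewrite -mulr_sumr -hE [X in _ = _ * X]h_rs -scalerAl -scalerAr scalerA mulVf ?lead_coef_eq0 //.
by rewrite scale1r -qE.
Qed.

(** Both alternatives of [exists_code_iff] involve only quantifiers over F and
    equations between elements of K that do not mention y0; membership in the
    ideal is such a condition because degrees are bounded. *)
Lemma nf_exists_code : nf (fun g (y : k.-tuple K) => exists y0, code c m [tuple of y0 :: y] g).
Proof.
have qP I s (z : T * T -> (I -> F) -> F) : (forall x, tdef (z x)) ->
  kpoly (fun e y => qpoly y (fun t => z (s, t) e)).
  by move=> dz; apply: kpoly_qpoly => t; apply: dz.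
have qpoly0 y z : qpoly y z = 0 <-> forall j : 'I_D, (qpoly y z)`_j = 0.
  split=> [-> j|z0]; first by rewrite coef0.
  apply/polyP => j; rewrite coef0; have [lt|le] := ltnP j D.
    exact: (z0 (Ordinal lt)).
  by rewrite nth_default // (leq_trans (size_qpoly y z)).
have nf_zero : nf (fun (g : T * T -> F) y => forall s, qpoly y (fun t => g (s, t)) = 0).
  apply: nf_qf; apply: qf_forall_fin => s.
  apply: (@qf_ext _ _ (fun g y => forall j : 'I_D, (qpoly y (fun t => g (s, t)))`_j = 0)).
    by move=> g y; apply: iff_sym.
  apply: qf_forall_fin => j; apply: qf_eq.
  by apply: kpoly_qpoly => t; apply: tdef_var.
have nf_span_zero : nf (fun g y => forall z, qpoly y z = 0 -> span_of g z).
  pose A (x : T * T + T -> F) (y : k.-tuple K) :=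
    qpoly y (fun t => x (inr t)) = 0 /\ ~ span_of (fun q => x (inl q)) (fun t => x (inr t)).
  apply: (@nf_ext _ _ (fun g y => ~ exists z, A (sumf g z) y)).
    move=> g y; split=> [no_z z z0|g_span [z [z0]]].
      by apply: NNPP => z_span; apply: no_z; exists z.
    by apply; apply: g_span.
  apply: nf_not; apply: nf_exists_fun; apply: nf_and.
    apply: nf_qf; apply: (@qf_ext _ _ (fun x y =>
        forall j : 'I_D, (qpoly y (fun t => x (inr t)))`_j = 0)).
      by move=> x y; apply: iff_sym.
    apply: qf_forall_fin => j; apply: qf_eq.
    by apply: kpoly_qpoly => t; apply: tdef_var.
  by apply/nf_fdef/fdef_not; apply: fdef_span_of => [q|t]; apply: tdef_var.
(* A product of fewer than D polynomials with at most D coefficients each. *)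
pose E := (D * D).+1.
pose ideal_eq l (x : T * T + 'I_l * T -> F) (y : k.-tuple K) :=
  exists a : T * 'I_(D + D + E) -> K, forall j : 'I_(D + D + E + D),
    (\prod_i qpoly y (fun t => x (inr (i, t))))`_j =
    \sum_u a u * ('X^(u.2) * qpoly y (fun t => x (inl (u.1, t))))`_j.
pose bad l (x : T * T + 'I_l * T -> F) (y : k.-tuple K) :=
  (forall i, ~ span_of (fun q => x (inl q)) (fun t => x (inr (i, t)))) /\ ideal_eq l x y.
have nf_bad (l : 'I_D) : nf (bad l).
  apply: nf_and.
    apply/nf_fdef; apply: fdef_forall_fin => i; apply/fdef_not.
    by apply: fdef_span_of => [q|t]; apply: tdef_var.
  apply: nf_qf; apply: (@qf_in_span _ _ _ _
    (fun (j : 'I_(D + D + E + D)) x y => (\prod_i qpoly y (fun t => x (inr (i, t))))`_j)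
    (fun (u : T * 'I_(D + D + E)) (j : 'I_(D + D + E + D)) x y =>
       ('X^(u.2) * qpoly y (fun t => x (inl (u.1, t))))`_j)) => [j|u j].
    apply: (@kpoly_prod _ _ l (fun i x y => qpoly y (fun t => x (inr (i, t))))) => i.
    by apply: kpoly_qpoly => t; apply: tdef_var.
  apply: (@kpolyXnM _ _ u.2 (fun x y => qpoly y (fun t => x (inl (u.1, t))))).
  by apply: kpoly_qpoly => t; apply: tdef_var.
apply: (@nf_ext _ _ (fun g y =>
    ((forall s, qpoly y (fun t => g (s, t)) = 0) /\
       forall z, qpoly y z = 0 -> span_of g z) \/
    (~ (forall s, qpoly y (fun t => g (s, t)) = 0) /\
       ~ exists l : 'I_D, exists z, bad l (sumf g z) y))); last first.
  apply: nf_or; first exact: nf_and.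
  apply: nf_and; first exact: nf_not.
  by apply: nf_not; apply: nf_exists_fin => l; apply: (nf_exists_fun (nf_bad l)).
move=> g y; apply: iff_trans (iff_sym (exists_code_iff y g)).
have [P0|P_neq0] := classic (forall s, qpoly y (fun t => g (s, t)) = 0); first by tauto.
have [s0 Ps0] := not_all_ex_not _ _ P_neq0.
suffices badE l (z : 'I_l * T -> F) : (l < D)%N -> ideal_eq l (sumf g z) y <->
    in_ideal (fun s => qpoly y (fun t => g (s, t))) (\prod_i qpoly y (fun t => z (i, t))).
  suffices : (exists l : 'I_D, exists z, bad l (sumf g z) y) <->
      (exists l : 'I_D, bad_factors y g l) by tauto.
  by split=> -[l [z [z_bad z_in]]]; exists l, z; split=> //; apply/badE.
move=> lt_lD; rewrite (in_ideal_span (D := D) (E := E) (t0 := s0)) //.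
- by move=> t; apply: size_qpoly.
- exact/eqP.
apply: leq_trans (size_poly_prod_leq _ _) _; apply: leq_trans (leq_subr _ _) _.
rewrite ltnS; apply: leq_trans (_ : (\sum_(i < l) D <= _)%N).
  by apply: leq_sum => i _; apply: size_qpoly.
by rewrite sum_nat_const card_ord leq_mul // ltnW.
Qed.

End ExistsK.

(** A predicate of a code of (y0, y) holds for some y0 when it holds for some g
    that is a code of (y0, y) for some y0. *)
Lemma nf_existsK (I : Type) (k : nat) (A : (I -> F) -> k.+1.-tuple K -> Prop) :
  nf A -> nf (fun e y => exists y0, A e [tuple of y0 :: y]).
Proof.
move=> [T [c [m [B [dB BE]]]]].
pose C (x : I + T * T -> F) (y : k.-tuple K) :=
  B x /\ exists y0, code c m [tuple of y0 :: y] (fun q => x (inr q)).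
apply: (@nf_ext _ _ (fun e y => exists g, C (sumf e g) y)).
  move=> e y; split=> [[g [Bg [y0 g_code]]]|[y0 Ay0]].
    by exists y0; apply: (BE _ _ g g_code).2.
  have [g g_code] := code_exists c m [tuple of y0 :: y].
  by exists g; split; [apply: (BE _ _ g g_code).1 | exists y0].
apply: nf_exists_fun; apply: nf_and; first exact: nf_fdef.
exact: (nf_reindex _ (nf_exists_code c m)).
Qed.

Lemma tdef_ring_eval n (t : ring_term n) :
  tdef (fun e : 'I_n -> F => ring_eval [tuple e i | i < n] t).
Proof.
elim: t => [i|||t dt u du|t dt|t dt u du] /=.
- suffices -> : (fun e : 'I_n -> F => tnth [tuple e j | j < n] i) = (fun e => e i).
    exact: tdef_var.
  by apply: functional_extensionality => e; rewrite tnth_mktuple.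
- exact: tdef0.
- exact: tdef1.
- exact: tdefD.
- exact: tdefN.
- exact: tdefM.
Qed.

Lemma kdef_Keval n k (t : Kterm n k) :
  kdef (fun (e : 'I_n -> F) y => Keval chi [tuple e i | i < n] y t).
Proof.
elim: t => [j|t|||t dt u du|t dt|t dt u du] /=.
- exact: kdef_var.
- exact/kdef_chi/tdef_ring_eval.
- exact: kdef0.
- exact: kdef1.
- exact: kdefD.
- exact: kdefN.
- exact: kdefM.
Qed.

Lemma mktuple_cons n (x : F) (e : 'I_n -> F) :
  [tuple of x :: [tuple e i | i < n]] = [tuple cons_fun x e i | i < n.+1].
Proof.
apply: eq_from_tnth => i; rewrite tnth_mktuple /cons_fun.
by case: (unliftP ord0 i) => [j|] -> /=; rewrite ?tnthS ?tnth_mktuple ?tnth0.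
Qed.

Lemma nf_existsF n k (A : ('I_n.+1 -> F) -> k.-tuple K -> Prop) :
  nf A -> nf (fun (e : 'I_n -> F) y => exists x, A (cons_fun x e) y).
Proof.
move=> nA; pose s (i : 'I_n.+1) : 'I_n + unit :=
  if unlift ord0 i is Some j then inl j else inr tt.
have sE e g : (fun i => sumf e g (s i)) = cons_fun (g tt) e.
  apply: functional_extensionality => i; rewrite /s /cons_fun.
  by case: (unlift ord0 i).
apply: nf_ext (nf_exists_fun (nf_reindex s nA)) => e y.
split=> [[g]|[x Ax]]; first by rewrite sE; exists (g tt).
by exists (fun=> x); rewrite sE.
Qed.

(** By induction on f; only the quantifiers over the second sort need an
    argument, which is [nf_existsK]. *)
Lemma nf_Lholds n k (f : Lformula n k) :
  nf (fun (e : 'I_n -> F) y => Lholds chi [tuple e i | i < n] y f).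
Proof.
elim: f => {n k} [n k t u|n k t u|n k f nff|n k f nff g nfg|n k f nff g nfg
  |n k f nff g nfg|n k f nff|n k f nff|n k f nff|n k f nff] /=.
- apply: (@nf_fdef k _ (fun e : 'I_n -> F => ring_eval [tuple e i | i < n] t =
    ring_eval [tuple e i | i < n] u)).
  by apply: fdef_eq; apply: tdef_ring_eval.
- apply: nf_qf; apply: qf_ext (qf_eq (kdefD (kdef_Keval t) (kdefN (kdef_Keval u)))).
  by move=> e y; split=> [/eqP|->]; rewrite ?subrr // subr_eq0 => /eqP.
- exact: nf_not.
- exact: nf_and.
- exact: nf_or.
- apply: nf_ext (nf_or (nf_not nff) nfg) => e y.
  by have := classic (Lholds chi [tuple e i | i < n] y f); tauto.
- apply: nf_ext (nf_existsF nff) => e y.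
  by split=> -[x]; exists x; [rewrite mktuple_cons | rewrite -mktuple_cons].
- apply: nf_ext (nf_not (nf_existsF (nf_not nff))) => e y.
  split=> [no_x x|Ax [x]]; last by rewrite -mktuple_cons; apply.
  by apply: NNPP; rewrite mktuple_cons => nAx; apply: no_x; exists x.
- exact: (nf_existsK nff).
- apply: nf_ext (nf_not (nf_existsK (nf_not nff))) => e y.
  by split=> [no_y y0|Ay [y0]]; [apply: NNPP => nAy; apply: no_y; exists y0 | apply].
Qed.

Lemma fdef_code0 (T : finType) (c : T -> int) (m : T -> 'I_0 -> nat) :
  fdef (fun g => code c m [tuple] g).
Proof.
have shape0 (z : T -> F) : shape_sum c m [tuple] z = \sum_t (c t)%:~R * chi (z t).
  by apply: eq_bigr => t _; rewrite /monomial_at big_ord0 mulr1.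
have d_shape I (z : T -> (I -> F) -> F) : (forall t, tdef (z t)) ->
    fdef (fun e => shape_sum c m [tuple] (fun t => z t e) = 0).
  move=> dz; apply: fdef_ext (fdef_subst (fdef_vanishing_sum c) dz) => e.
  by rewrite shape0.
apply: fdef_and.
  by apply: fdef_forall_fin => s; apply: d_shape => t; apply: tdef_var.
pose A (x : T * T + T -> F) := shape_sum c m [tuple] (fun t => x (inr t)) = 0 ->
  span_of (fun q => x (inl q)) (fun t => x (inr t)).
apply: (@fdef_ext _ _ (fun g => forall z, A (sumf g z))) => //.
apply: fdef_forall_fun; apply: fdef_imp.
  by apply: d_shape => t; apply: tdef_var.
by apply: fdef_span_of => [q|t]; apply: tdef_var.
Qed.

Lemma mktuple_tnth n (a : n.-tuple F) : [tuple tnth a i | i < n] = a.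
Proof. by apply: eq_from_tnth => i; rewrite tnth_mktuple. Qed.

(** A code of the parameters from K serves as a tuple of parameters from F. *)
Lemma definable_field_definable m (D : m.-tuple F -> Prop) :
  definable chi D -> field_definable D.
Proof.
move=> [r [s [f [b [d DE]]]]].
have [T [c [w [B [dB BE]]]]] := nf_Lholds f.
have [g g_code] := code_exists c w d.
pose n := #|{: T * T}|; pose b' := [tuple of b ++ [tuple g (enum_val i) | i < n]].
pose h (x : 'I_(m + r) + T * T) : 'I_(m + (r + n)) := cast_ord (esym (addnA m r n))
  match x with inl i => lshift n i | inr q => rshift (m + r) (enum_rank q) end.
have [phi phiE] := fdef_ring_formula h dB.
exists (r + n)%N, phi, b' => a; rewrite phiE DE.
rewrite -{1}[[tuple of a ++ b]]mktuple_tnth (BE _ _ _ g_code).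
suffices -> : (fun i => tnth [tuple of a ++ b'] (h i)) =
  sumf (tnth [tuple of a ++ b]) g by [].
have size_ab : size (a ++ b) = (m + r)%N by rewrite size_cat !size_tuple.
apply: functional_extensionality => -[i|q]; rewrite /= !(tnth_nth 0) /= catA nth_cat size_ab.
  by rewrite /= ltn_ord.
rewrite /= ltnNge leq_addr /= addKn (nth_map (enum_rank q)) ?size_enum_ord //.
by rewrite nth_ord_enum enum_rankK.
Qed.

(** The code is quantified away: the codes of the empty tuple form a 0-definable
    set. *)
Lemma definable0_field_definable0 m (D : m.-tuple F -> Prop) :
  definable0 chi D -> field_definable0 D.
Proof.
move=> [f DE]; have [T [c [w [B [dB BE]]]]] := nf_Lholds f.
pose C (x : 'I_m + T * T -> F) := code c w [tuple] (fun q => x (inr q)) /\ B x.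
have dC : fdef (fun e => exists g, C (sumf e g)).
  apply: fdef_exists_fun; apply: fdef_and => //.
  exact: (fdef_reindex _ (fdef_code0 c w)).
have [phi phiE] := fdef_ring_formula id dC; exists phi => a.
rewrite phiE DE -{1}[a]mktuple_tnth; split=> [Da|[g [g_code Bg]]].
  have [g g_code] := code_exists c w [tuple].
  by exists g; split=> //; apply: (BE _ _ _ g_code).1 Da.
exact: (BE _ _ g g_code).2 Bg.
Qed.

(** * Preimages of algebraic sets *)

Lemma Fp_sub_int (z : int) : Fp_sub p (z%:~R : F).
Proof.
rewrite /Fp_sub; move: charF p_prime_or_0; rewrite /has_char.
case: p => [charF0 _|q charFq [q_pr|//]]; first by exists z%:~R; rewrite ratr_int.
have [n ->] : exists n, z%:~R = n%:R :> F.
  case: z => n; first by exists n.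
  exists (q * n.+1)%N; rewrite NegzE mulrNz -pmulrn.
  apply/eqP; rewrite eq_sym -subr_eq0 opprK -natrD -mulSnr natrM.
  by rewrite (pcharf0 charFq) mul0r.
exists n%:R; rewrite val_Fp_nat // {1}(divn_eq n q.+1) natrD natrM.
by rewrite (pcharf0 charFq) mulr0 add0r.
Qed.

Lemma meval_chi_monomials m (P : {mpoly K[m]}) (a : m.-tuple F) :
  P.@[tnth [tuple of map chi a]] =
  \sum_(i < size (msupp P)) P@_(nth 0%MM (msupp P) i) *
     chi (monomial_at (tnth a) (nth 0%MM (msupp P) i)).
Proof.
rewrite mevalE (big_nth 0%MM) big_mkord; apply: eq_bigr => i _; congr (_ * _).
by rewrite chi_monomial; apply: eq_bigr => j _; rewrite tnth_map.
Qed.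

(** The polynomials over k that vanish on D have no other common zero, as soon as
    they separate D from each point outside. *)
Lemma defined_over_separation (k : F -> Prop) m (D : m.-tuple F -> Prop) :
  (forall a, ~ D a -> exists P : {mpoly F[m]}, [/\ forall w, k P@_w,
     P.@[tnth a] <> 0 & forall b, D b -> P.@[tnth b] = 0]) ->
  defined_over k D.
Proof.
move=> sep; exists (fun P => (forall w, k P@_w) /\ forall b, D b -> P.@[tnth b] = 0).
split=> [P []//|a]; split=> [Da P [_]|a0]; first exact.
by apply: NNPP => /sep[P [kP Pa P0]]; apply/Pa/a0.
Qed.

(** A polynomial P that does not vanish at chi(a) yields a relation over the ring
    generated by chi which holds on D and fails at a. Expanding its coefficients
    into values of chi turns it into a vanishing sum in the monomials of a with
    coefficients from F, and these can be separated by a polynomial. *)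
Lemma chi_preimage_algebraic m (V : m.-tuple K -> Prop) (D : m.-tuple F -> Prop) :
  is_algebraic V -> (forall a, D a <-> chi_preimage chi V a) -> is_algebraic D.
Proof.
move=> [S SV] DV.
suffices [S' [_ S'D]] : defined_over (fun=> True) D by exists S'.
apply: defined_over_separation => a NDa.
have DE b : D b <-> forall P, S P -> P.@[tnth [tuple of map chi b]] = 0.
  by rewrite DV /chi_preimage SV.
have [P nP] := not_all_ex_not _ _ (fun a0 => NDa ((DE a).2 a0)).
have [SP Pa] := imply_to_and _ _ nP.
pose n := size (msupp P); pose w (i : 'I_n) := nth 0%MM (msupp P) i.
pose r (b : m.-tuple F) : 'rV[K]_n := \row_i chi (monomial_at (tnth b) (w i)).
have [N N_R N_eq] := chi_ring_equations (fun i => P@_(w i)).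
have PE (b : m.-tuple F) : P.@[tnth [tuple of map chi b]] = 0 <-> r b *m N = 0.
  rewrite -N_eq => [|i]; last by rewrite mxE; apply: chi_ring_chi.
  rewrite meval_chi_monomials.
  suffices -> : \sum_i r b 0 i * P@_(w i) = \sum_(i < size (msupp P)) P@_(nth 0%MM (msupp P) i) *
     chi (monomial_at (tnth b) (nth 0%MM (msupp P) i)) by [].
  by apply: eq_bigr => i _; rewrite mxE mulrC.
have [l Nl] : exists l, (r a *m N) 0 l <> 0.
  apply: not_all_ex_not => N0; apply/Pa/PE/matrixP => i l.
  by rewrite (ord1 i) N0 mxE.
have /fin_all_exists[s sE] (i : 'I_n) := N_R i l.
pose L := [seq (q, w i) | i <- enum 'I_n, q <- s i].
pose u (b : m.-tuple F) (j : 'I_(size L)) :=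
  let x := tnth (in_tuple L) j in x.1.2 * monomial_at (tnth b) x.2.
have uE (b : m.-tuple F) : (r b *m N) 0 l =
    \sum_j (tnth (in_tuple L) j).1.1%:~R * chi (u b j).
  rewrite -(big_tnth _ _ L predT (fun x => x.1.1%:~R * chi (x.1.2 * monomial_at (tnth b) x.2))).
  rewrite /L big_allpairs_dep mxE big_enum; apply: eq_bigr => i _.
  rewrite mxE sE mulr_sumr; apply: eq_bigr => q _ /=.
  by rewrite chiM mulrC -mulrA.
have [|G G_a G0] := vanishing_sum_separation (u := u a)
    (c := fun j => (tnth (in_tuple L) j).1.1).
  by rewrite -uE; apply/eqP.
pose lF := [tuple (let x := tnth (in_tuple L) j in
  x.1.2 *: 'X_[x.2] : {mpoly F[m]}) | j < size L].
have lFE (b : m.-tuple F) : (map_mpoly intr G \mPo lF).@[tnth b] = mmap intr (u b) G.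
  rewrite comp_mpoly_meval -meval_map_int; apply: meval_eq => j.
  by rewrite tnth_mktuple mevalZ mevalX.
exists (map_mpoly intr G \mPo lF); split=> // [|b Db].
  by rewrite lFE; apply/eqP.
rewrite lFE; apply: G0; rewrite -uE.
by have /DE/(_ P SP)/PE-> := Db; rewrite mxE.
Qed.

(** With rational coefficients it is enough to clear denominators: the vanishing
    sum is then one in the monomials of a, and the separating polynomial has
    integer coefficients. *)
Lemma chi_preimage_defined_over m (V : m.-tuple K -> Prop) (D : m.-tuple F -> Prop) :
  defined_over (@rat_sub K) V -> (forall a, D a <-> chi_preimage chi V a) ->
  defined_over (@Fp_sub p F) D.
Proof.
move=> [S [S_rat SV]] DV; apply: defined_over_separation => a NDa.
have DE b : D b <-> forall P, S P -> P.@[tnth [tuple of map chi b]] = 0.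
  by rewrite DV /chi_preimage SV.
have [P nP] := not_all_ex_not _ _ (fun a0 => NDa ((DE a).2 a0)).
have [SP Pa] := imply_to_and _ _ nP.
pose n := size (msupp P); pose w (i : 'I_n) := nth 0%MM (msupp P) i.
have /fin_all_exists[q qE] (i : 'I_n) := S_rat P SP (w i).
pose d := \prod_i denq (q i).
have d_neq0 : d%:~R != 0 :> K.
  by rewrite intr_eq0_char0 //; apply/prodf_neq0 => i _; apply: denq_neq0.
pose c i := numq (q i) * \prod_(j | j != i) denq (q j).
have cE i : (c i)%:~R = d%:~R * P@_(w i).
  have den_neq0 : (denq (q i))%:~R != 0 :> K by rewrite intr_eq0_char0 // denq_neq0.
  rewrite qE /ratr /d (bigD1 i) //= [in LHS]rmorphM [in RHS]rmorphM /=.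
  by rewrite [RHS]mulrC -mulrA mulKf.
have PE (b : m.-tuple F) : d%:~R * P.@[tnth [tuple of map chi b]] =
    \sum_i (c i)%:~R * chi (monomial_at (tnth b) (w i)).
  rewrite meval_chi_monomials mulr_sumr; apply: eq_bigr => i _.
  by rewrite cE mulrA.
have [|G G_a G0] := vanishing_sum_separation (c := c) (u := fun i => monomial_at (tnth a) (w i)).
  by rewrite -PE mulf_neq0 //; apply/eqP.
pose l := [tuple 'X_[w i] : {mpoly int[m]} | i < n].
have lE (b : m.-tuple F) : (map_mpoly intr (G \mPo l)).@[tnth b] =
    mmap intr (fun i => monomial_at (tnth b) (w i)) G.
  rewrite meval_map_int mmap_comp_mpoly -!meval_map_int; apply: meval_eq => i.
  by rewrite tnth_mktuple mmapX.
exists (map_mpoly intr (G \mPo l)); split=> [v||b Db].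
- by rewrite mcoeff_map_mpoly; apply: Fp_sub_int.
- by rewrite lE; apply/eqP.
by rewrite lE; apply: G0; rewrite -PE; have /DE/(_ P SP)-> := Db; rewrite mulr0.
Qed.

End Character.

Theorem theorem1p9 (p : nat) (F K : closedFieldType) (chi : F -> K)
    (p_prime_or_0 : prime p \/ p = 0%N) (chi_model : is_ACFC_model p chi)
    (m : nat) (D : m.-tuple F -> Prop) :
  [/\ definable chi D -> field_definable D,
      definable0 chi D -> field_definable0 D
    & forall V : m.-tuple K -> Prop,
        is_algebraic V -> (forall a, D a <-> chi_preimage chi V a) ->
        is_algebraic D /\
        (defined_over (@rat_sub K) V -> defined_over (@Fp_sub p F) D)].
Proof.
have [charF charK chi_char chi_gen] := chi_model; split.
- exact: (definable_field_definable charK chi_char chi_gen p_prime_or_0 charF).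
- exact: (definable0_field_definable0 charK chi_char chi_gen p_prime_or_0 charF).
move=> V V_alg DV; split.
  exact: (chi_preimage_algebraic charK chi_char chi_gen p_prime_or_0 charF V_alg DV).
move=> V_rat.
exact: (chi_preimage_defined_over charK chi_char chi_gen p_prime_or_0 charF V_rat DV).
Qed.
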